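(* Let $d\geq 2$ be an integer that is either equal to $3$ or even. For every integer $N\geq 1$ and every $\nu\in\mathbb{R}^N\setminus\{0\}$, there exist a non-symmetric smooth embedding $U:\mathbb{T}^N\to C^\infty_{\mathrm{div}}(\mathbb{T}^d,\mathbb{R}^d)$ and a family of initial data $u_\theta\in C^\infty_{\mathrm{div}}(\mathbb{T}^d,\mathbb{R}^d)$, $\theta\in\mathbb{T}^N$, such that, for each $\theta\in\mathbb{T}^N$, the solution to the incompressible Euler equations on $\mathbb{T}^d$ with initial datum $u_\theta$ is $$u_\theta(t,\cdot)=U(\theta+\nu t).$$
   Context: Here $\mathbb{T}^k:=(\mathbb{R}/2\pi\mathbb{Z})^k$, and for $\theta\in\mathbb{T}^N$, $\nu\in\mathbb{R}^N$, $t\in\mathbb{R}$, the point $\theta+\nu t\in\mathbb{T}^N$ is understood modulo $2\pi\mathbb{Z}^N$. $C^\infty_{\mathrm{div}}(\mathbb{T}^d,\mathbb{R}^d)$ denotes the space of smooth divergence-free vector fields on $\mathbb{T}^d$ (with its usual $C^\infty$ Fréchet topology). The incompressible Euler equations on $\mathbb{T}^d$ are $$\partial_t u+u\cdot\nabla u+\nabla p=0,\qquad \operatorname{div}u=0,$$ for the time-dependent velocity field $u(t,x)\in\mathbb{R}^d$ and the scalar pressure $p(t,x)$. The map $U$ is called non-symmetric if, for all $\theta\in\mathbb{T}^N$, the divergence-free vector field $U(\theta)$ is not invariant under any (nontrivial) 1-parameter group of translations on $\mathbb{T}^d$, i.e. for no $a\in\mathbb{R}^d\setminus\{0\}$ does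 one have $U(\theta)(x+sa)=U(\theta)(x)$ for all $x\in\mathbb{T}^d$ and $s\in\mathbb{R}$. The frequency vector $\nu$ is not assumed to be irrational, and the embedding $U$ may depend on $\nu$. *)

(* Defs.v *)
From mathcomp Require Import all_boot all_order all_algebra.
From mathcomp Require Import all_classical all_reals all_analysis.

Set Implicit Arguments.
Unset Strict Implicit.
Unset Printing Implicit Defensive.

Import Order.TTheory GRing.Theory Num.Theory.
Import numFieldNormedType.Exports.

Local Open Scope classical_set_scope.
Local Open Scope ring_scope.

(* Points of the torus (R/2 pi Z)^n are represented by their lifts in R^n,
   and maps on the torus by 2 pi Z^n-periodic maps on R^n. *)

Definition period {R : realType} {n : nat} (k : 'rV[int]_n) : 'rV[R]_n :=
  (2 * pi) *: map_mx (fun z : int => z%:~R) k.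

Definition torus_eq {R : realType} {n : nat} (x y : 'rV[R]_n) : Prop :=
  exists k : 'rV[int]_n, y = x + period k.

Definition torus_periodic {R : realType} {n : nat} {T : Type}
    (f : 'rV[R]_n -> T) : Prop :=
  forall (x : 'rV[R]_n) (k : 'rV[int]_n), f (x + period k) = f x.

(* Convergence for the quotient topology of the torus. *)
Definition torus_cvg {R : realType} {n : nat}
    (F : set_system 'rV[R]_n) (x : 'rV[R]_n) : Prop :=
  forall B : set 'rV[R]_n, nbhs x B ->
    F [set y | exists2 z, B z & torus_eq y z].

Fixpoint iter_derive {R : realType} {V W : normedModType R}
    (s : seq V) (f : V -> W) : V -> W :=
  if s is v :: s' then 'D_v (iter_derive s' f) else f.

(* All iterated directional derivatives exist and are continuous; when V is
   finite-dimensional this is the usual class C^oo. *)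
Definition smooth {R : realType} {V W : normedModType R} (f : V -> W) : Prop :=
  forall s : seq V,
    continuous (iter_derive s f) /\
    forall x v : V, derivable (iter_derive s f) x v.

Definition basis_vec {R : realType} {d : nat} (i : 'I_d) : 'rV[R]_d :=
  delta_mx 0 i.

Definition divergence {R : realType} {d : nat}
    (v : 'rV[R]_d -> 'rV[R]_d) (x : 'rV[R]_d) : R :=
  \sum_(i < d) 'D_(basis_vec i) v x 0 i.

Definition gradient {R : realType} {d : nat}
    (p : 'rV[R]_d -> R) (x : 'rV[R]_d) : 'rV[R]_d :=
  \row_(i < d) 'D_(basis_vec i) p x.

Definition convective {R : realType} {d : nat}
    (v : 'rV[R]_d -> 'rV[R]_d) (x : 'rV[R]_d) : 'rV[R]_d :=
  \sum_(i < d) v x 0 i *: 'D_(basis_vec i) v x.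

Definition Cinf_div {R : realType} {d : nat} :
    set ('rV[R]_d -> 'rV[R]_d) :=
  [set v | [/\ torus_periodic v, smooth v & forall x, divergence v x = 0]].

(* Convergence in the Frechet topology of C^oo: uniform convergence of the
   derivatives of each order. *)
Definition Cinf_cvg {R : realType} {d : nat}
    (F : set_system ('rV[R]_d -> 'rV[R]_d))
    (v : 'rV[R]_d -> 'rV[R]_d) : Prop :=
  forall s : seq 'rV[R]_d,
    {uniform, iter_derive s @ F --> iter_derive s v}.

Definition Cinf_continuous {R : realType} {N d : nat}
    (U : 'rV[R]_N -> 'rV[R]_d -> 'rV[R]_d) : Prop :=
  forall theta : 'rV[R]_N, Cinf_cvg (U @ theta) (U theta).

(* w is the derivative of U at theta in the direction e, the limit of the
   difference quotients being taken in the Frechet topology. *)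
Definition Cinf_is_derive {R : realType} {N d : nat}
    (U : 'rV[R]_N -> 'rV[R]_d -> 'rV[R]_d) (theta e : 'rV[R]_N)
    (w : 'rV[R]_d -> 'rV[R]_d) : Prop :=
  Cinf_cvg
    ((fun (h : R) (x : 'rV[R]_d) =>
        h^-1 *: (U (theta + h *: e) x - U theta x)) @ 0^')
    w.

Fixpoint Cinf_Ck {R : realType} {N d : nat} (k : nat)
    (U : 'rV[R]_N -> 'rV[R]_d -> 'rV[R]_d) : Prop :=
  (forall theta : 'rV[R]_N, Cinf_div (U theta)) /\ Cinf_continuous U /\
  if k is k'.+1 then
    forall e : 'rV[R]_N,
      exists2 dU : 'rV[R]_N -> 'rV[R]_d -> 'rV[R]_d,
        forall theta : 'rV[R]_N, Cinf_is_derive U theta e (dU theta) &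
        Cinf_Ck k' dU
  else True.

(* Smooth injective immersion of the torus T^N into C^oo_div(T^d, R^d) that is
   a homeomorphism onto its image.  (The range of the differential is
   finite-dimensional, hence complemented, so injectivity of the differential
   is all that an immersion requires.) *)
Definition smooth_embedding {R : realType} {N d : nat}
    (U : 'rV[R]_N -> 'rV[R]_d -> 'rV[R]_d) : Prop :=
  [/\ torus_periodic U,
      forall k, Cinf_Ck k U,
      forall theta phi : 'rV[R]_N, U theta = U phi -> torus_eq theta phi,
      forall (theta e : 'rV[R]_N) (w : 'rV[R]_d -> 'rV[R]_d),
        Cinf_is_derive U theta e w -> w = (fun=> 0) -> e = 0 &
      forall (F : set_system 'rV[R]_N) (theta : 'rV[R]_N), ProperFilter F ->
        Cinf_cvg (U @ F) (U theta) -> torus_cvg F theta].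

Definition non_symmetric {R : realType} {N d : nat}
    (U : 'rV[R]_N -> 'rV[R]_d -> 'rV[R]_d) : Prop :=
  forall theta : 'rV[R]_N,
    ~ exists2 a : 'rV[R]_d, a != 0 &
        forall (x : 'rV[R]_d) (s : R), U theta (x + s *: a) = U theta x.

Definition euler_solution {R : realType} {d : nat}
    (u0 : 'rV[R]_d -> 'rV[R]_d) (u : R -> 'rV[R]_d -> 'rV[R]_d) : Prop :=
  [/\ u 0 = u0,
      smooth (fun z : R * 'rV[R]_d => u z.1 z.2),
      forall t, Cinf_div (u t) &
      exists p : R -> 'rV[R]_d -> R,
        [/\ smooth (fun z : R * 'rV[R]_d => p z.1 z.2),
            forall t, torus_periodic (p t) &
            forall (t : R) (x : 'rV[R]_d),
              'D_1 (fun s => u s x) t + convective (u t) x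
                + gradient (p t) x = 0]].

(* Solutions are classical, smooth and defined for all times; "the" solution
   is understood as the existence of u together with its uniqueness. *)
Definition the_euler_solution {R : realType} {d : nat}
    (u0 : 'rV[R]_d -> 'rV[R]_d) (u : R -> 'rV[R]_d -> 'rV[R]_d) : Prop :=
  euler_solution u0 u /\
  forall v : R -> 'rV[R]_d -> 'rV[R]_d, euler_solution u0 v -> v = u.

(* Main.v *)
(* Cut the circle of the coordinate x_2 into N + 1 disjoint strips.  A shear flow b(x) e_1 with b
   independent of x_1 is a steady solution; take b constant, equal to nu_j, around the j-th strip,
   and put there a compactly supported radial vortex centred at x_1 = theta_j.  A radial vortex is a
   steady solution with a compactly supported pressure, and by Galilean invariance it is carried by
   the uniform stream nu_j e_1.  As the supports are disjoint, the sum U(theta) of the shear and of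
   the vortices evolves as U(theta + t nu).  The vortices determine theta, and the derivative in
   theta_j is nonzero at the j-th centre, so U is an embedding.  Vortices break the translation
   invariance in x_1 and x_2; in the strip number N, b is a sum of cosines of the other coordinates,
   which breaks the remaining ones.

   Uniqueness is the energy method: |v - u|^2 satisfies a differential inequality up to a
   divergence, and Gronwall's lemma applies to its averages. *)

Require Import Defs.
From HB Require Import structures.
From mathcomp Require Import all_boot all_order all_algebra.
From mathcomp Require Import all_classical all_reals all_analysis.
From mathcomp Require Import lra ring zify.
Import Order.TTheory GRing.Theory Num.Theory.
Import numFieldNormedType.Exports.
Local Open Scope classical_set_scope.
Local Open Scope ring_scope.

Set Implicit Arguments.
Unset Strict Implicit.
Unset Printing Implicit Defensive.

(** * Smooth maps *)

(** Two reductions carry the analysis. The family [U] is handled as one smooth function of the pair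
    (theta, x): its derivative in theta is again of this kind, and compactness of the torus turns
    local estimates into the uniform ones of the Frechet topology. The Euler equations become an
    identity between directional derivatives of that function, time acting as the direction (nu, 0).
    The obstacle in the construction is to be smooth, periodic and explicit at once. All profiles
    come from exp (-1/x), and the squared distance to the lattice, not smooth half way between
    lattice points, is flattened away from it. Lengths are measured in units of 1/M with M = N + 4:
    the centre lines are at least 2 pi / M apart, the background is constant within 1/M of a centre
    line and cut off at 2/M, and the vortices have squared radius 1 / (2 M^2). As 2 pi >= 4 the
    strips are disjoint, and as M >= 4 they lie where the flattened distance is the true one. *)

Fixpoint Ck {R : realType} {V W : normedModType R} (k : nat) (f : V -> W) : Prop :=
  (continuous f /\ forall x v, derivable f x v) /\
  if k is k'.+1 then forall v, Ck k' ('D_v f) else True.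

Section Smooth.
Context {R : realType}.
Implicit Types (U V W : normedModType R) (k : nat).

Lemma iter_derive_rcons V W (s : seq V) v (f : V -> W) :
  iter_derive (rcons s v) f = iter_derive s ('D_v f).
Proof. by elim: s => //= w s ->. Qed.

Lemma Ck_base V W k (f : V -> W) : Ck k f ->
  continuous f /\ forall x v, derivable f x v.
Proof. by case: k => [[]|k []]. Qed.

(** [Ck] peels off the innermost derivative and [iter_derive] the outermost one, hence the induction
    from the end of the list. Closure properties are proved for [Ck], where the derivative of a
    product or of a composition is built from functions of smaller order. *)
Lemma smoothP V W (f : V -> W) : smooth f <-> forall k, Ck k f.
Proof.
split=> [sf k|cf s].
  elim: k f sf => [|k IH] f sf; first by split => //; exact: (sf [::]).
  split; first exact: (sf [::]).
  by move=> v; apply: IH => s; rewrite -iter_derive_rcons; apply: sf.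
elim/last_ind: s f cf => [|s v IH] f cf; first exact: (Ck_base (cf 0%N)).
rewrite iter_derive_rcons; apply: IH => k.
by have [_] := cf k.+1; exact.
Qed.

Lemma CkW V W k (f : V -> W) : Ck k.+1 f -> Ck k f.
Proof.
elim: k f => [|k IH] f [fb fD]; first by split.
by split => // v; apply: IH.
Qed.

Lemma Ck_D V W k (f : V -> W) v : Ck k.+1 f -> Ck k ('D_v f).
Proof. by move=> [_]; exact. Qed.

Lemma smooth_continuous V W (f : V -> W) : smooth f -> continuous f.
Proof. by move=> /(_ [::]) []. Qed.

Lemma smooth_derivable V W (f : V -> W) x v : smooth f -> derivable f x v.
Proof. by move=> /(_ [::]) [_]; exact. Qed.

Lemma smooth_derive V W (f : V -> W) v : smooth f -> smooth ('D_v f).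
Proof. by move=> sf s; rewrite -iter_derive_rcons; exact: sf. Qed.

Lemma smooth_iter_derive V W (f : V -> W) s : smooth f -> smooth (iter_derive s f).
Proof.
elim/last_ind: s f => // s v IH f sf; rewrite iter_derive_rcons.
exact/IH/smooth_derive.
Qed.

Lemma eq_smooth V W (f g : V -> W) : f =1 g -> smooth f -> smooth g.
Proof. by move=> /funext ->. Qed.

Lemma Ck_cst V W k (w : W) : Ck k (cst w : V -> W).
Proof.
elim: k w => [|k IH] w; (split;
  [split=> x; [exact: cst_continuous|move=> v; exact: derivable_cst]|]) => //.
move=> v; rewrite (_ : 'D_v _ = cst 0) //.
by apply/funext => x; rewrite derive_cst.
Qed.

Lemma smooth_cst V W (w : W) : smooth (fun _ : V => w).
Proof. by apply/smoothP => k; exact: Ck_cst. Qed.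

Lemma Ck_add V W k (f g : V -> W) : Ck k f -> Ck k g -> Ck k (fun x => f x + g x).
Proof.
elim: k f g => [|k IH] f g [[cf df] Df] [[cg dg] Dg]; (split;
  [split=> x; [exact: (continuousD (cf x) (cg x))|move=> v; exact: (derivableD (df x v) (dg x v))]|]) => //.
move=> v; rewrite (_ : 'D_v _ = fun x => 'D_v f x + 'D_v g x); first exact: IH (Df v) (Dg v).
by apply/funext => x; apply: deriveD.
Qed.

Lemma smooth_add V W (f g : V -> W) : smooth f -> smooth g -> smooth (fun x => f x + g x).
Proof. by move=> /smoothP sf /smoothP sg; apply/smoothP => k; exact: Ck_add. Qed.

Lemma smooth_sum V W I (r : seq I) (P : pred I) (f : I -> V -> W) :
  (forall i, P i -> smooth (f i)) -> smooth (fun x => \sum_(i <- r | P i) f i x).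
Proof.
move=> sf; elim: r => [|i r IH].
  by apply: (eq_smooth _ (smooth_cst 0)) => x; rewrite big_nil.
apply: (@eq_smooth _ _ (fun x => (if P i then f i x else 0) + \sum_(j <- r | P j) f j x)).
  by move=> x; rewrite big_cons; case: ifP => // _; rewrite add0r.
by apply: smooth_add IH; case Pi: (P i); [exact: sf|exact: smooth_cst].
Qed.

Lemma Ck_mul V k (f g : V -> R) : Ck k f -> Ck k g -> Ck k (fun x => f x * g x).
Proof.
elim: k f g => [|k IH] f g Cf Cg; have [cf df] := Ck_base Cf; have [cg dg] := Ck_base Cg;
  (split; [split=> x; [exact: (continuousM (cf x) (cg x))
                      |move=> v; exact: (derivableM (df x v) (dg x v))]|]) => //.
move=> v; rewrite (_ : 'D_v _ = fun x => f x * 'D_v g x + g x * 'D_v f x).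
  exact: Ck_add (IH _ _ (CkW Cf) (Ck_D v Cg)) (IH _ _ (CkW Cg) (Ck_D v Cf)).
by apply/funext => x; apply: (deriveM (df x v) (dg x v)).
Qed.

Lemma smooth_mul V (f g : V -> R) : smooth f -> smooth g -> smooth (fun x => f x * g x).
Proof. by move=> /smoothP sf /smoothP sg; apply/smoothP => k; exact: Ck_mul. Qed.

Lemma smooth_opp V (f : V -> R) : smooth f -> smooth (fun x => - f x).
Proof.
move=> sf; apply: (@eq_smooth _ _ (fun x => -1 * f x)).
  by move=> x; rewrite mulN1r.
exact: smooth_mul (smooth_cst _) sf.
Qed.

Lemma is_derive_lin V W W' (L : {linear W -> W'}) (f : V -> W) x v :
  continuous L -> derivable f x v -> is_derive x v (L \o f) (L ('D_v f x)).
Proof.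
move=> cL df.
have H : (fun h => h^-1 *: (((L \o f) \o shift x) (h *: v) - (L \o f) x)) @ 0^' --> L ('D_v f x).
  rewrite (_ : (fun _ => _) = L \o (fun h => h^-1 *: ((f \o shift x) (h *: v) - f x))).
    by apply: continuous_cvg; [exact: cL|exact: df].
  by apply/funext => h /=; rewrite -linearB -linearZZ.
by split; [apply/cvg_ex; exists (L ('D_v f x))|exact: cvg_lim H].
Qed.

Lemma Ck_lin V W W' (L : {linear W -> W'}) k (f : V -> W) :
  continuous L -> Ck k f -> Ck k (fun x => L (f x)).
Proof.
move=> cL; elim: k f => [|k IH] f Cf; have [cf df] := Ck_base Cf;
  (split; [split=> x; [apply: continuous_comp (cf x) _; exact: cL
                      |move=> v; by have [] := is_derive_lin cL (df x v)]|]) => //.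
move=> v; rewrite (_ : 'D_v _ = fun x => L ('D_v f x)); first by apply: IH; exact: Ck_D.
by apply/funext => x; have [_ ->] := is_derive_lin cL (df x v).
Qed.

Lemma smooth_lin V W W' (L : {linear W -> W'}) (f : V -> W) :
  continuous L -> smooth f -> smooth (fun x => L (f x)).
Proof. by move=> cL /smoothP sf; apply/smoothP => k; exact: Ck_lin. Qed.

Lemma smooth_scalel V W (f : V -> R) (w : W) : smooth f -> smooth (fun x => f x *: w).
Proof.
have lin : linear (fun h : R => h *: w) by move=> ? ? ?; rewrite scalerDl scalerA.
pose L : {linear R -> W} := HB.pack (fun h : R => h *: w) (GRing.isLinear.Build _ _ _ _ _ lin).
exact: (@smooth_lin V R W L f (@scalel_continuous _ _ w)).
Qed.

Lemma smooth_id V : smooth (id : V -> V).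
Proof.
apply/smoothP => -[|k]; (split; [split=> x; [exact: cvg_id|move=> v; exact: derivable_id]|]) => //.
move=> v; rewrite (_ : 'D_v _ = cst v); first exact: Ck_cst.
by apply/funext => x; rewrite derive_id.
Qed.

Lemma smooth_coord V m n (f : V -> 'M[R]_(m, n)) i j : smooth f -> smooth (fun x => f x i j).
Proof.
have lin : linear (fun M : 'M[R]_(m, n) => M i j) by move=> ? ? ?; rewrite !mxE.
pose L : {linear 'M[R]_(m, n) -> R} :=
  HB.pack (fun M : 'M[R]_(m, n) => M i j) (GRing.isLinear.Build _ _ _ _ _ lin).
exact: (@smooth_lin V _ R L f (@coord_continuous _ _ _ i j)).
Qed.

Lemma derive_coord V n (f : V -> 'rV[R]_n) x v i : derivable f x v ->
  'D_v f x 0 i = 'D_v (fun y => f y 0 i) x.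
Proof. by move=> df; rewrite derive_mx // mxE. Qed.

(* [L] is affine with linear part [L0], so that 'D_v (f \o L) = ('D_(L0 v) f) \o L. *)
Definition affine_map U V (L : U -> V) (L0 : U -> V) :=
  continuous L /\ forall x v (h : R), L (h *: v + x) = h *: L0 v + L x.

Lemma is_derive_affine U V W (L L0 : U -> V) (f : V -> W) x v :
  affine_map L L0 -> derivable f (L x) (L0 v) ->
  is_derive x v (f \o L) ('D_(L0 v) f (L x)).
Proof.
move=> [cL aL] df.
have E : (fun h => h^-1 *: (((f \o L) \o shift x) (h *: v) - (f \o L) x)) =
         (fun h => h^-1 *: ((f \o shift (L x)) (h *: L0 v) - f (L x))).
  by apply/funext => h /=; rewrite aL.
by split; [rewrite /derivable E|rewrite /derive E].
Qed.

Lemma Ck_affine U V W (L L0 : U -> V) k (f : V -> W) :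
  affine_map L L0 -> Ck k f -> Ck k (fun x => f (L x)).
Proof.
move=> aL; elim: k f => [|k IH] f Cf; have [cf df] := Ck_base Cf;
  (split; [split=> x; [exact: (continuous_comp (aL.1 x) (cf (L x)))
                      |by move=> v; have [] := is_derive_affine aL (df (L x) (L0 v))]|]) => //.
move=> v; rewrite (_ : 'D_v _ = fun x => 'D_(L0 v) f (L x)).
  exact: (IH ('D_(L0 v) f) (Ck_D _ Cf)).
by apply/funext => x; have [_ ->] := is_derive_affine aL (df (L x) (L0 v)).
Qed.

Lemma smooth_affine U V W (L L0 : U -> V) (f : V -> W) :
  affine_map L L0 -> smooth f -> smooth (fun x => f (L x)).
Proof. by move=> aL /smoothP sf; apply/smoothP => k; exact: Ck_affine aL _. Qed.

Lemma derive_line V W (f : V -> W) x v :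
  'D_1 (fun s : R => f (s *: v + x)) 0 = 'D_v f x.
Proof.
rewrite /derive; set g1 := fun h => h^-1 *: _; set g2 := fun h => h^-1 *: _.
suff -> : g1 = g2 by [].
by apply/funext => h; rewrite /g1 /g2 /= addr0 scale0r add0r [_%:A]mulr1.
Qed.

(** Only a derivative of [f] in the direction [v] is available, so the one-variable chain rule is
    applied to the restriction of [f] to the line through [x]. *)
Lemma is_derive_comp1 V (h : R -> R) (f : V -> R) x v :
  derivable h (f x) 1 -> derivable f x v ->
  is_derive x v (fun y => h (f y)) ('D_1 h (f x) * 'D_v f x).
Proof.
move=> dh df.
pose phi (s : R) := f (s *: v + x).
have phi0 : phi 0 = f x by rewrite /phi scale0r add0r.
have dphi : derivable phi 0 1 by exact: (derivable1P f x v).1 df.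
have phi'0 : phi^`()%classic 0 = 'D_v f x.
  by rewrite derive1E derive_line.
have dh0 : derivable h (phi 0) 1 by rewrite phi0.
have dhphi : derivable (h \o phi) 0 1.
  apply/(derivable1_diffP (h \o phi) 0).
  exact: differentiable_comp ((derivable1_diffP phi 0).1 dphi) ((derivable1_diffP h _).1 dh0).
split; first exact: (derivable1P (fun y => h (f y)) x v).2 dhphi.
transitivity ((h \o phi)^`()%classic 0).
  by rewrite derive1E -derive_line.
by rewrite (derive1_comp dphi dh0) phi'0 phi0 derive1E.
Qed.

Lemma is_derive_compf V (h : R -> R) (f : V -> R) x v (a b : R) :
  is_derive (f x) (1 : R) h a -> is_derive x v f b -> is_derive x v (fun y => h (f y)) (a * b).
Proof. by move=> [dh <-] [df <-]; exact: is_derive_comp1. Qed.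

Lemma Ck_comp1 V k (h : R -> R) (f : V -> R) : Ck k h -> Ck k f -> Ck k (fun x => h (f x)).
Proof.
elim: k h f => [|k IH] h f Ch Cf; have [cf df] := Ck_base Cf; have [ch dh] := Ck_base Ch;
  (split; [split=> x; [apply: continuous_comp (cf x) _; exact: ch
           |by move=> v; have [] := is_derive_comp1 (dh (f x) 1) (df x v)]|]) => //.
move=> v; rewrite (_ : 'D_v _ = fun x => 'D_1 h (f x) * 'D_v f x).
  exact: (@Ck_mul _ k (fun x => 'D_1 h (f x)) _ (IH ('D_1 h) f (Ck_D (1 : R) Ch) (CkW Cf)) (Ck_D v Cf)).
by apply/funext => x; have [_ ->] := is_derive_comp1 (dh (f x) 1) (df x v).
Qed.

Lemma smooth_comp1 V (h : R -> R) (f : V -> R) :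
  smooth h -> smooth f -> smooth (fun x => h (f x)).
Proof. by move=> /smoothP sh /smoothP sf; apply/smoothP => k; exact: Ck_comp1. Qed.

Lemma Ck_inv V k (f : V -> R) : (forall x, f x != 0) -> Ck k f -> Ck k (fun x => (f x)^-1).
Proof.
move=> f0; elim: k => [|k IH] Cf; have [cf df] := Ck_base Cf;
  (split; [split=> x; [exact: (continuousV (f0 x) (cf x))|move=> v; exact: derivableV]|]) => //.
move=> v; rewrite (_ : 'D_v _ = fun x => -1 * ((f x)^-1 * (f x)^-1 * 'D_v f x)).
  by apply: Ck_mul; [exact: Ck_cst|apply: Ck_mul; [apply: Ck_mul; apply: IH; exact: CkW|exact: Ck_D]].
apply/funext => x; rewrite (deriveV (f0 x) (df x v)).
by rewrite mulN1r -expr2 exprVn -mulNr.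
Qed.

Lemma smooth_inv V (f : V -> R) : (forall x, f x != 0) -> smooth f -> smooth (fun x => (f x)^-1).
Proof. by move=> f0 /smoothP sf; apply/smoothP => k; exact: Ck_inv. Qed.

Lemma near_eq_iter_derive V W s (f g : V -> W) (x : V) :
  (\near x, f x = g x) -> \near x, iter_derive s f x = iter_derive s g x.
Proof.
move=> fg; elim: s => //= v s /near_join.
by apply: filterS => y; exact: near_eq_derive.
Qed.

(** Iterated derivatives depend only on germs. This serves for functions that are defined through a
    floor and have jumps only in appearance. *)
Lemma smooth_local V W (f : V -> W) :
  (forall x : V, exists2 g : V -> W, smooth g & \near x, f x = g x) -> smooth f.
Proof.
move=> H s; split=> x.
  have [g sg /near_eq_iter_derive-/(_ s) E] := H x.
  rewrite /continuous_at (nbhs_singleton E).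
  apply: (cvg_trans _ (smooth_continuous (smooth_iter_derive s sg) (x := x))).
  by apply: near_eq_cvg; apply: filterS E => y.
move=> v; have [g sg /near_eq_iter_derive-/(_ s) E] := H x.
have dg : derivable (iter_derive s g) x v by exact/smooth_derivable/smooth_iter_derive.
have E' : {near x, iter_derive s g =1 iter_derive s f}.
  by apply: filterS E => y ->.
exact: near_eq_derivable E' dg.
Qed.

End Smooth.

Arguments smooth_derivable {R V W f} x v.

(** * Mean value theorem along a line and symmetry of second derivatives *)

Section Schwarz.
Context {R : realType}.
Implicit Types (U V W : normedModType R).

Lemma affine_line V (x v : V) : affine_map (fun s : R => s *: v + x) (fun s => s *: v).
Proof.
split; last by move=> a s h /=; rewrite scalerDl scalerA addrA.
by move=> s; apply: cvgD; [exact: scalel_continuous|exact: cvg_cst].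
Qed.

(** The increment [h] may have either sign, whence a bound on the absolute value of [c] instead of
    an interval. *)
Lemma MVT_line V (f : V -> R) (x v : V) (h : R) :
  (forall y, derivable f y v) ->
  exists2 c, `|c| <= `|h| & f (h *: v + x) - f x = h * 'D_v f (c *: v + x).
Proof.
move=> df; pose phi (s : R) := f (s *: v + x).
have dphi (s : R) : is_derive s (1 : R) phi ('D_v f (s *: v + x)).
  have := @is_derive_affine R R V R _ _ f s 1 (affine_line x v).
  by rewrite scale1r; apply; exact: df.
have cphi : continuous phi.
  by move=> s; apply/differentiable_continuous/derivable1_diffP; have [] := dphi s.
have phi0 : phi 0 = f x by rewrite /phi scale0r add0r.
have [h0|h0] := leP 0 h.
  have [c] := @MVT_segment _ phi _ 0 h h0 (fun s _ => dphi s) (continuous_subspaceT cphi).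
  rewrite in_itv /= phi0 subr0 => /andP[c0 ch] E; exists c; first by rewrite !ger0_norm.
  by rewrite E mulrC.
have [c] := @MVT_segment _ phi _ h 0 (ltW h0) (fun s _ => dphi s) (continuous_subspaceT cphi).
rewrite in_itv /= phi0 sub0r => /andP[c0 ch] E; exists c.
  by rewrite ler0_norm // ltr0_norm // lerN2.
by rewrite -/(phi h) -opprB E; ring.
Qed.

(** The second difference of [f] over the parallelogram spanned by [h *: v] and [h *: w] is
    symmetric in [v] and [w]. Two mean value theorems write it as h^2 times a mixed derivative at a
    nearby point, in either order, and continuity concludes. *)
Lemma Schwarz_real V (f : V -> R) v w : smooth f -> 'D_v ('D_w f) = 'D_w ('D_v f).
Proof.
move=> sf; apply/funext => x.
have dd u y : derivable f y u by exact: smooth_derivable.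
have ddd u u' y : derivable ('D_u f) y u'.
  exact/smooth_derivable/smooth_derive.
have cc u u' : continuous ('D_u ('D_u' f)).
  exact/smooth_continuous/smooth_derive/smooth_derive.
have key u u' (h : R) : exists c c', [/\ `|c| <= `|h|, `|c'| <= `|h| &
   f (h *: u + (h *: u' + x)) - f (h *: u' + x) - (f (h *: u + x) - f x) =
   h * (h * 'D_u ('D_u' f) (c *: u + (c' *: u' + x)))].
  pose A y := f (h *: u + y) - f y.
  have aff : affine_map (fun y => h *: u + y) id.
    split; first by move=> y; apply: cvgD; [exact: cvg_cst|exact: cvg_id].
    by move=> y z k /=; rewrite addrCA.
  have dA y : is_derive y u' A ('D_u' f (h *: u + y) - 'D_u' f y).
    have H1 := is_derive_affine aff (dd u' (h *: u + y)).
    have H2 : is_derive y u' f ('D_u' f y) by split.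
    exact: is_deriveB H1 H2.
  have dA' y : derivable A y u' by have [] := dA y.
  have [c' c'h E] := @MVT_line V A x u' h dA'.
  have [c ch E2] := @MVT_line V ('D_u' f) (c' *: u' + x) u h (ddd _ _).
  exists c, c'; split => //.
  rewrite -/(A (h *: u' + x)) -/(A x) E.
  by have [_ ->] := dA (c' *: u' + x); rewrite E2.
apply/eqP; rewrite -subr_eq0 -normr_le0; apply/ler_addgt0Pr => e e0; rewrite add0r.
have e2 : 0 < e / 2 by rewrite divr_gt0.
have := cc v w x; move/cvgrPdist_lt => /(_ _ e2)/nbhs_ballP[r1 /= r10 B1].
have := cc w v x; move/cvgrPdist_lt => /(_ _ e2)/nbhs_ballP[r2 /= r20 B2].
pose r := Num.min r1 r2.
have r0 : 0 < r by rewrite lt_min r10.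
pose M := `|v| + `|w| + 1.
have M0 : 0 < M by rewrite ltr_wpDl // addr_ge0.
(* For this [h] the intermediate points stay in the ball of radius [r], where both mixed derivatives
   vary by less than e / 2. *)
pose h := r / M / 2.
have h0 : 0 < h by rewrite !divr_gt0.
have small (u u' : V) (c c' : R) : `|u| + `|u'| = `|v| + `|w| -> `|c| <= `|h| -> `|c'| <= `|h| ->
  ball x r (c *: u + (c' *: u' + x)).
  move=> uu'; rewrite (gtr0_norm h0) => ch c'h; rewrite -ball_normE /=.
  rewrite addrA -normrN opprB addrK.
  apply: (le_lt_trans (ler_normD _ _)); rewrite !normrZ.
  apply: (@le_lt_trans _ _ (h * (`|u| + `|u'|))).
    by rewrite mulrDr lerD // ler_wpM2r.
  rewrite uu'; apply: (@lt_le_trans _ _ (h * M)).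
    by rewrite ltr_pM2l // /M ltrDl.
  by rewrite /h mulrAC divfK ?gt_eqF// ler_pdivrMr // ler_pMr // ler1n.
have [c1 [c1' [h1 h1' E1]]] := key v w h.
have [c2 [c2' [h2 h2' E2]]] := key w v h.
have E : 'D_v ('D_w f) (c1 *: v + (c1' *: w + x)) = 'D_w ('D_v f) (c2 *: w + (c2' *: v + x)).
  have hn : h != 0 by rewrite gt_eqF.
  apply/(mulfI hn)/(mulfI hn)/(etrans (esym E1))/(etrans _ E2).
  by rewrite [h *: v + (_ + _)]addrCA; ring.
have S1 := small v w c1 c1' erefl h1 h1'.
have S2 := small w v c2 c2' (addrC _ _) h2 h2'.
have L1 := B1 _ (le_ball _ S1).
have L2 := B2 _ (le_ball _ S2).
rewrite -(subrKA ('D_v ('D_w f) (c1 *: v + (c1' *: w + x)))) (splitr e).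
apply: (le_trans (ler_normD _ _)); apply: lerD.
  by apply/ltW/L1; rewrite ge_min lexx.
by rewrite E distrC; apply/ltW/L2; rewrite ge_min lexx orbT.
Qed.

Lemma Schwarz V n (f : V -> 'rV[R]_n) v w : smooth f -> 'D_v ('D_w f) = 'D_w ('D_v f).
Proof.
move=> sf; apply/funext => x; apply/rowP => i.
have H1 : derivable ('D_w f) x v by exact/smooth_derivable/smooth_derive.
have H2 : derivable ('D_v f) x w by exact/smooth_derivable/smooth_derive.
apply: (etrans (derive_coord i H1)); apply: (etrans _ (esym (derive_coord i H2))).
have E u : (fun y => 'D_u f y 0 i) = 'D_u (fun y => f y 0 i).
  by apply/funext => y; rewrite (derive_coord i (smooth_derivable y u sf)).
rewrite (E w) (E v).
exact: (congr1 (@^~ x) (Schwarz_real v w (smooth_coord 0 i sf))).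
Qed.

Lemma iter_derive_Schwarz V n (f : V -> 'rV[R]_n) v s :
  smooth f -> iter_derive s ('D_v f) = 'D_v (iter_derive s f).
Proof.
move=> sf; elim: s => [//|w s IH]; apply: (etrans (congr1 (fun g => 'D_w g) IH)).
exact: Schwarz (smooth_iter_derive s sf).
Qed.

Lemma iter_derive_affine U V W (L L0 : U -> V) (f : V -> W) s :
  affine_map L L0 -> smooth f ->
  iter_derive s (fun x => f (L x)) = fun x => iter_derive (map L0 s) f (L x).
Proof.
move=> aL sf; elim: s => //= v s ->; apply/funext => x.
have [] // := is_derive_affine aL (_ : derivable (iter_derive (map L0 s) f) (L x) (L0 v)).
exact/smooth_derivable/smooth_iter_derive.
Qed.

Lemma iter_derive_diff_quotient V W (f g : V -> W) (k : R) s :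
  smooth f -> smooth g ->
  iter_derive s (fun x => k *: (f x - g x)) =
  fun x => k *: (iter_derive s f x - iter_derive s g x).
Proof.
move=> sf sg; elim: s => //= v s ->; apply/funext => x.
have df := smooth_derivable x v (smooth_iter_derive s sf).
have dg := smooth_derivable x v (smooth_iter_derive s sg).
by rewrite (deriveZ k (derivableB df dg)) deriveB.
Qed.

End Schwarz.

(** * From local to uniform statements on the torus *)

Section Periodic.
Context {R : realType}.
Local Notation "''rV_' n" := ('rV[R]_n).

Lemma periodE n (k : 'rV[int]_n) i : (period k : 'rV[R]_n) 0 i = 2 * pi * (k 0 i)%:~R.
Proof. by rewrite /period !mxE. Qed.

Lemma twopi_gt0 : 0 < 2 * pi :> R.
Proof. by rewrite mulr_gt0 // pi_gt0. Qed.

Definition cell n : set 'rV[R]_n := [set x | forall i, `[0, 2 * pi]%classic (x ord0 i)].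

Lemma compact_cell n : compact (@cell n).
Proof. by apply: (@rV_compact _ _ (fun=> `[0, 2 * pi]%classic)) => i; exact: segment_compact. Qed.

Lemma cell_reduce n (x : 'rV[R]_n) : exists2 k : 'rV[int]_n, cell (x + period k) & True.
Proof.
exists (\row_i (- Num.floor (x 0 i / (2 * pi)))) => // i.
rewrite /= in_itv /= mxE periodE mxE.
have /andP[l u] := floor_itv (x ord0 i / (2 * pi)).
rewrite ler_pdivlMr ?twopi_gt0 // in l; rewrite ltr_pdivrMr ?twopi_gt0 // in u.
rewrite intrD mulrDl mul1r in u; rewrite rmorphN /= mulrN.
by rewrite [2 * pi * _]mulrC subr_ge0 l lerBlDr addrC ltW.
Qed.

(** Compactness of the cell, in near-covering form, makes the member of [F] independent of [x];
    periodicity carries the conclusion from the cell to the whole space. The uniform estimates for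
    the Frechet topology are obtained from it. *)
Lemma periodic_near n (I : Type) (F : set_system I) (P : I -> 'rV[R]_n -> Prop) :
  Filter F -> (forall i x k, P i (x + period k) -> P i x) ->
  (forall x : 'rV[R]_n, \forall x' \near x & i \near F, P i x') ->
  \forall i \near F, forall x, P i x.
Proof.
move=> FF perP loc.
have := (compact_near_coveringP (@cell n)).1 (@compact_cell n) I F P FF (fun x _ => loc x).
apply: filterS => i Pi x; have [k xk _] := cell_reduce x.
exact/perP/Pi.
Qed.

Lemma rV_norm_lt n (M : 'rV[R]_n) (e : R) : 0 < e -> (forall i, `|M 0 i| < e) -> `|M| < e.
Proof.
move=> e0 H; rewrite [ltLHS]/Num.Def.normr /= mx_normrE.
by apply: bigmax_lt => // -[j i] _ /=; rewrite ord1.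
Qed.

Lemma coord_norm_le n (M : 'rV[R]_n) i : `|M 0 i| <= `|M|.
Proof. by rewrite [leRHS]/Num.Def.normr /= mx_normrE; exact: (le_bigmax _ _ (0, i)). Qed.

End Periodic.

(** * Smooth families of solenoidal fields *)

Section CinfTopology.
Context {R : realType}.

Lemma Cinf_cvgP d (F : set_system ('rV[R]_d -> 'rV[R]_d)) (v : 'rV[R]_d -> 'rV[R]_d)
  {FF : Filter F} :
  Cinf_cvg F v <-> forall s e, 0 < e ->
    F [set u | forall x, `|iter_derive s v x - iter_derive s u x| < e].
Proof.
split=> [cv s e e0|H s P].
  apply: (cv s [set u | forall x, `|iter_derive s v x - u x| < e]); apply/uniform_nbhs.
  exists [set z | `|z.1 - z.2| < e]; split; last by move=> u /= H x; exact: H.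
  rewrite -entourage_ballE; exists e => // z /=.
  by rewrite -ball_normE.
move=> /uniform_nbhs[E [entE subP]].
move: entE; rewrite -entourage_ballE => -[e /= e0 Ee].
apply: filterS (H s e e0) => u /= Hu; apply: subP => x _ /=.
by apply: Ee; rewrite /= -ball_normE /=.
Qed.

Section JointlySmooth.
Variables (N d : nat).
Implicit Types G : 'rV[R]_N -> 'rV[R]_d -> 'rV[R]_d.

(** The invariant of the induction on the order of differentiability: it gives continuity into the
    Frechet space and is inherited by the derivatives in theta. *)
Definition jointly_smooth_solenoidal G :=
  [/\ smooth (fun z : 'rV[R]_N * 'rV[R]_d => G z.1 z.2),
      forall theta, torus_periodic (G theta) &
      forall theta x, divergence (G theta) x = 0].

(** Through this map, the derivative of a slice along [v] is the derivative of the joint function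
    along (0, v). *)
Lemma affine_slice {U V : normedModType R} (u : U) : affine_map (fun x : V => (u, x)) (pair 0).
Proof.
split; first by move=> x; apply: cvg_pair; [exact: cvg_cst|exact: cvg_id].
by move=> x v h; apply/pair_equal_spec; split; rewrite /= ?scaler0 ?add0r.
Qed.

Lemma affine_slice1 {U V : normedModType R} (u : U) : affine_map (fun x : V => (x, u)) (fun x => (x, 0)).
Proof.
split; first by move=> x; apply: cvg_pair; [exact: cvg_id|exact: cvg_cst].
by move=> x v h; apply/pair_equal_spec; split; rewrite /= ?scaler0 ?add0r.
Qed.

Lemma iter_derive_slice G theta s :
  smooth (fun z : 'rV[R]_N * 'rV[R]_d => G z.1 z.2) ->
  iter_derive s (G theta) =
  fun x => iter_derive (map (pair 0) s) (fun z : 'rV[R]_N * 'rV[R]_d => G z.1 z.2) (theta, x).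
Proof. by move=> sG; rewrite -(iter_derive_affine s (affine_slice theta) sG). Qed.

Lemma iter_derive_periodic (W : normedModType R) (f : 'rV[R]_d -> W) s :
  torus_periodic f -> torus_periodic (iter_derive s f).
Proof.
move=> pf; elim: s => //= v s IH x k; rewrite /derive.
suff -> : (fun h => h^-1 *: ((iter_derive s f \o shift (x + period k)) (h *: v) -
     iter_derive s f (x + period k))) =
  (fun h => h^-1 *: ((iter_derive s f \o shift x) (h *: v) - iter_derive s f x)) by [].
by apply/funext => h /=; rewrite addrA !IH.
Qed.

Lemma smooth_slice G theta : smooth (fun z : 'rV[R]_N * 'rV[R]_d => G z.1 z.2) -> smooth (G theta).
Proof. exact: smooth_affine (affine_slice theta). Qed.

(** The joint iterated derivative is continuous at (theta, x). Comparing both parameters with its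
    value there gives a bound valid for all points near [x], which [periodic_near] makes uniform. *)
Lemma jointly_smooth_Cinf_continuous G : jointly_smooth_solenoidal G -> Cinf_continuous G.
Proof.
move=> [sG pG _] theta.
have FF := fmap_filter G (nbhs_filter theta).
apply/(Cinf_cvgP _ (FF := FF)) => s e e0.
pose H := iter_derive (map (pair 0) s) (fun z : 'rV[R]_N * 'rV[R]_d => G z.1 z.2).
have cH : continuous H by exact/smooth_continuous/smooth_iter_derive.
apply: (@periodic_near R d _ (nbhs theta)
  (fun phi x => `|iter_derive s (G theta) x - iter_derive s (G phi) x| < e)).
  by move=> phi x k; rewrite !(iter_derive_periodic s (pG _)).
move=> x.
have e2 : 0 < e / 2 by rewrite divr_gt0.
have := cH (theta, x); move/cvgrPdist_lt => /(_ _ e2)[[A B] /= [nA nB] AB].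
exists (B, A) => //= -[x' phi] /= [Bx' Aphi].
rewrite !(iter_derive_slice _ _ sG) -/H.
have H1 := AB (phi, x') (conj Aphi Bx').
have H2 := AB (theta, x') (conj (nbhs_singleton nA) Bx').
rewrite -(subrKA (H (theta, x))) (splitr e).
by apply: (le_lt_trans (ler_normD _ _)); apply: ltrD => //; rewrite distrC.
Qed.

Definition dparam G (e : 'rV[R]_N) theta x :=
  'D_(e, 0) (fun z : 'rV[R]_N * 'rV[R]_d => G z.1 z.2) (theta, x).

Lemma dparamE G e : (fun z : 'rV[R]_N * 'rV[R]_d => dparam G e z.1 z.2) =
  'D_(e, 0) (fun z => G z.1 z.2).
Proof. by apply/funext => -[]. Qed.

Lemma dparam_periodic G e theta :
  (forall theta, torus_periodic (G theta)) -> torus_periodic (dparam G e theta).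
Proof.
move=> pG x k; rewrite /dparam /derive.
suff -> : (fun h => h^-1 *: (((fun z : 'rV[R]_N * 'rV[R]_d => G z.1 z.2) \o
            shift (theta, x + period k)) (h *: (e, 0)) - G theta (x + period k))) =
   (fun h => h^-1 *: (((fun z : 'rV[R]_N * 'rV[R]_d => G z.1 z.2) \o
            shift (theta, x)) (h *: (e, 0)) - G theta x)) by [].
by apply/funext => h /=; rewrite !scaler0 !add0r !pG.
Qed.

(** The divergence vanishes for all theta, so its derivative along (e, 0) vanishes too, and the
    symmetry of second derivatives moves that derivative inside. *)
Lemma dparam_jointly_smooth G e :
  jointly_smooth_solenoidal G -> jointly_smooth_solenoidal (dparam G e).
Proof.
move=> [sG pG dG]; split.
- by rewrite dparamE; exact: (smooth_derive (e, 0) sG).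
- by move=> theta; exact: dparam_periodic.
move=> theta x.
pose Gh := fun z : 'rV[R]_N * 'rV[R]_d => G z.1 z.2.
have slice (H : 'rV[R]_N * 'rV[R]_d -> 'rV[R]_d) th y v : smooth H ->
    'D_v (fun x => H (th, x)) y = 'D_(0, v) H (th, y).
  by move=> sH; have [] // := is_derive_affine (affine_slice th) (smooth_derivable (th, y) (0, v) sH).
have E : (fun z => \sum_(i < d) ('D_(0, basis_vec i) Gh z) 0 i) = cst 0.
  apply/funext => -[th y]; rewrite -[RHS](dG th y); apply: eq_bigr => i _.
  by rewrite -(slice Gh).
have : 'D_(e, 0) (fun z => \sum_(i < d) ('D_(0, basis_vec i) Gh z) 0 i) (theta, x) = 0.
  by rewrite E derive_cst.
rewrite (_ : (fun z => _) = \sum_(i < d) (fun z => ('D_(0, basis_vec i) Gh z) 0 i)); last first.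
  by apply/funext => z; rewrite fct_sumE.
rewrite derive_sum; last first.
  by move=> i; apply/smooth_derivable/smooth_coord/smooth_derive.
move=> <-; apply: eq_bigr => i _.
rewrite (slice ('D_(e, 0) Gh)); last exact: smooth_derive.
transitivity ('D_(e, 0) ('D_(0, basis_vec i) Gh) (theta, x) 0 i).
  apply: (congr1 (fun M : 'rV[R]_d => M 0 i)).
  exact: (congr1 (@^~ (theta, x)) (Schwarz (0, basis_vec i) (e, 0) sG)).
apply: derive_coord; exact/smooth_derivable/smooth_derive.
Qed.

(** By symmetry of the derivatives, a space derivative of [dparam] is the derivative along (e, 0) of
    the same space derivative [H] of [G]. The mean value theorem turns the difference quotient of
    [H] into that derivative at a point of the segment, and continuity compares the two. *)
Lemma dparam_is_derive G theta e :
  jointly_smooth_solenoidal G -> Cinf_is_derive G theta e (dparam G e theta).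
Proof.
move=> [sG pG dG].
have FF := fmap_filter (fun h x => h^-1 *: (G (theta + h *: e) x - G theta x)) (dnbhs_filter (0 : R)).
apply/(Cinf_cvgP _ (FF := FF)) => s eps e0.
pose Gh := fun z : 'rV[R]_N * 'rV[R]_d => G z.1 z.2.
pose H := iter_derive (map (pair 0) s) Gh.
have sH : smooth H by exact: smooth_iter_derive.
have EQ h x : iter_derive s (fun x => h^-1 *: (G (theta + h *: e) x - G theta x)) x =
    h^-1 *: (H (theta + h *: e, x) - H (theta, x)).
  rewrite iter_derive_diff_quotient; try exact: smooth_slice.
  by rewrite !(iter_derive_slice _ _ sG).
have ED x : iter_derive s (dparam G e theta) x = 'D_(e, 0) H (theta, x).
  have sdp : smooth (fun z : 'rV[R]_N * 'rV[R]_d => dparam G e z.1 z.2).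
    by rewrite dparamE; exact: (smooth_derive (e, 0) sG).
  rewrite (iter_derive_slice theta s sdp) dparamE.
  exact: (congr1 (@^~ (theta, x)) (iter_derive_Schwarz (e, 0) (map (pair 0) s) sG)).
apply: (@periodic_near R d R (0^') (fun h x =>
   `|iter_derive s (dparam G e theta) x -
     iter_derive s (fun x => h^-1 *: (G (theta + h *: e) x - G theta x)) x| < eps)).
  move=> h x k; rewrite (iter_derive_periodic s (dparam_periodic e theta pG)).
  rewrite (@iter_derive_periodic _ (fun x => h^-1 *: (G (theta + h *: e) x - G theta x))) //.
  by move=> y l; rewrite !pG.
move=> x.
have cD : continuous ('D_(e, 0) H) by exact/smooth_continuous/smooth_derive.
have e2 : 0 < eps / 2 by rewrite divr_gt0.
have := cD (theta, x); move/cvgrPdist_lt => /(_ _ e2)[[A B] /= [/nbhs_ballP[r /= r0 rA] nB] AB].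
have M0 : 0 < `|e| + 1 by rewrite ltr_wpDl.
(* The [+ 1] covers the case e = 0; the condition [h != 0] is there to cancel the inverse of [h]. *)
exists (B, [set h | `|h| * (`|e| + 1) < r /\ h != 0]) => /=.
  split => //; near=> h; split; last by near: h; exact: nbhs_dnbhs_neq.
  by rewrite -ltr_pdivlMr //; near: h; apply: dnbhs0_lt; exact: divr_gt0.
move=> [x' h] /= [Bx' [hr h0]]; rewrite EQ ED.
(* The mean value theorem needs real values, so it is applied to each coordinate, with a point [c]
   that depends on [i]. *)
apply: rV_norm_lt => // i; rewrite !mxE.
have [c ch MV] := @MVT_line R _ (fun z => H z 0 i) (theta, x') (e, 0) h
  (fun y => smooth_derivable y (e, 0) (smooth_coord 0 i sH)).
have -> : H (theta + h *: e, x') 0 i - H (theta, x') 0 i =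
    h * 'D_(e, 0) H (theta + c *: e, x') 0 i.
  rewrite derive_coord; last exact: smooth_derivable.
  have P k : k *: (e, 0 : 'rV[R]_d) + (theta, x') = (theta + k *: e, x').
    by apply/pair_equal_spec; split; rewrite /= ?scaler0 ?add0r // addrC.
  by rewrite !P in MV.
rewrite mulKf //.
have H1 : `|'D_(e, 0) H (theta, x) - 'D_(e, 0) H (theta + c *: e, x')| < eps / 2.
  apply: (AB (theta + c *: e, x')); split => //=; apply: rA.
  rewrite -ball_normE /= opprD addrA subrr sub0r normrN normrZ.
  apply: le_lt_trans hr; apply: ler_pM => //; by rewrite lerDl.
have H2 : `|'D_(e, 0) H (theta, x) - 'D_(e, 0) H (theta, x')| < eps / 2.
  by apply: (AB (theta, x')); split => //=; apply: rA; exact: ballxx.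
have := coord_norm_le ('D_(e, 0) H (theta, x') - 'D_(e, 0) H (theta + c *: e, x')) i.
rewrite !mxE => /le_lt_trans; apply.
rewrite -(subrKA ('D_(e, 0) H (theta, x))) (splitr eps).
apply: (le_lt_trans (ler_normD _ _)); apply: (ltrD _ H1).
by rewrite distrC; exact: H2.
Unshelve. all: by end_near. Qed.

Lemma jointly_smooth_Cinf_Ck G k : jointly_smooth_solenoidal G -> Cinf_Ck k G.
Proof.
elim: k G => [|k IH] G jG; (split; [|split; [exact: jointly_smooth_Cinf_continuous|]]) => //.
- by move=> theta; case: jG => sG pG dG; split => //; exact: smooth_slice.
- by move=> theta; case: jG => sG pG dG; split => //; exact: smooth_slice.
move=> e; exists (dparam G e); last exact/IH/dparam_jointly_smooth.
by move=> theta; exact: dparam_is_derive.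
Qed.

End JointlySmooth.
End CinfTopology.

(** * Uniqueness for the Euler equations *)

Section Slab.
Context {R : realType}.
Variable d : nat.
Implicit Types (T : R) (z : R * 'rV[R]_d).

Lemma slab_near T (I : Type) (F : set_system I) (P : I -> R * 'rV[R]_d -> Prop) :
  Filter F -> (forall i t x k, P i (t, x + period k) -> P i (t, x)) ->
  (forall z, \forall z' \near z & i \near F, P i z') ->
  \forall i \near F, forall t x, `|t| <= T -> P i (t, x).
Proof.
move=> FF perP loc.
have cK : compact (`[- T, T]%classic `*` @cell R d).
  by apply: compact_setX; [exact: segment_compact|exact: compact_cell].
have := (compact_near_coveringP _).1 cK I F P FF (fun z _ => loc z).
apply: filterS => i Pi t x tT; have [k xk _] := cell_reduce x.
by apply: (perP _ _ _ k); apply: Pi; split => //=; rewrite in_itv /= -ler_norml.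
Qed.

(** The candidate bound is the parameter of the covering argument, which runs along the filter at
    infinity. *)
Lemma slab_bounded T (g : R * 'rV[R]_d -> R) :
  continuous g -> (forall t, torus_periodic (fun x => g (t, x))) ->
  exists2 M, 0 < M & forall t x, `|t| <= T -> `|g (t, x)| <= M.
Proof.
move=> cg pg.
have : \forall M \near (pinfty_nbhs R), forall t x, `|t| <= T -> `|g (t, x)| <= M.
  have FF : Filter (pinfty_nbhs R) by exact: filter_filter.
  refine (@slab_near T R (pinfty_nbhs R) (fun M z => `|g z| <= M) FF _ _).
    by move=> M t x k; rewrite pg.
  move=> z; have := cg z; move/cvgrPdist_lt => /(_ _ ltr01) nz.
  exists ([set z' | `|g z - g z'| < 1], [set M | `|g z| + 1 <= M]) => /=.
    by split => //; apply: nbhs_pinfty_ge; exact: num_real.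
  move=> [z' M] /= [zz' gM]; apply: le_trans gM.
  rewrite -[g z'](subKr (g z)) (le_trans (ler_normB _ _)) // lerD2l.
  exact: ltW.
move=> H; near (pinfty_nbhs R) => M; exists M; last by near: M.
by near: M; exact: nbhs_pinfty_gt.
Unshelve. all: by end_near. Qed.

Lemma slab_unif_continuous T (g : R * 'rV[R]_d -> R) eps :
  continuous g -> (forall t, torus_periodic (fun x => g (t, x))) -> 0 < eps ->
  exists2 delta, 0 < delta & forall t x y, `|t| <= T -> `|y| < delta ->
    `|g (t, x) - g (t, y + x)| <= eps.
Proof.
move=> cg pg e0.
have : \forall y \near (0 : 'rV[R]_d), forall t x, `|t| <= T -> `|g (t, x) - g (t, y + x)| <= eps.
  refine (@slab_near T _ (nbhs (0 : 'rV[R]_d)) (fun y z => `|g z - g (z.1, y + z.2)| <= eps) _ _ _).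
    by move=> y t x k /=; rewrite addrA !(pg t).
  move=> z; have e2 : 0 < eps / 2 by rewrite divr_gt0.
  have := cg z; move/cvgrPdist_lt => /(_ _ e2)/nbhs_ballP[r /= r0 rz].
  exists (ball z (r / 2), ball 0 (r / 2)) => /=.
    by split; apply: nbhsx_ballx; rewrite divr_gt0.
  move=> [[t x] y] /= [[/= zt zx] y0].
  have r2 : r / 2 <= r by rewrite ler_pdivrMr // ler_pMr // ler1n.
  have H1 : `|g z - g (t, x)| < eps / 2.
    by apply: rz; split => /=; exact: le_ball r2 _ _.
  have H2 : `|g z - g (t, y + x)| < eps / 2.
    apply: rz; split => /=; first exact: le_ball r2 _ _.
    rewrite -ball_normE /= opprD addrA [_ - y]addrC -addrA.
    rewrite (splitr r) (le_lt_trans (ler_normD _ _)) // ltrD //.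
      by move: y0; rewrite -ball_normE /= sub0r.
    by move: zx; rewrite -ball_normE.
  rewrite -(subrKA (g z)) (splitr eps).
  apply: (le_trans (ler_normD _ _)); apply: lerD; last exact: ltW.
  by rewrite distrC; exact: ltW.
move=> /nbhs_ballP[delta /= d0 H]; exists delta => // t x y tT yd.
by apply: H => //; rewrite -ball_normE /= sub0r normrN.
Qed.

End Slab.

Section Gronwall.
Context {R : realType}.

(** The function exp (- C s) E(s) - A s has derivative at most A (exp (- C s) - 1) <= 0. *)
Lemma gronwall (E dE : R -> R) (T A C : R) : 0 <= A -> 0 <= C ->
  (forall t : R, is_derive t (1 : R) E (dE t)) -> E 0 = 0 ->
  (forall t : R, 0 <= t <= T -> dE t <= A + C * E t) ->
  forall t : R, 0 <= t <= T -> E t <= A * t * expR (C * t).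
Proof.
move=> A0 C0 dEE E0 HE t /andP[t0 tT].
pose psi (s : R) := expR (- C * s) * E s - A * s.
pose dpsi (s : R) := expR (- C * s) * (dE s - C * E s) - A.
have dpsiE (s : R) : is_derive s (1 : R) psi (dpsi s).
  have d1 : is_derive s (1 : R) (fun s => - C * s) (- C).
    have := is_deriveZ (- C) (is_derive_id s (1 : R)).
    by rewrite /GRing.scale /= mulr1.
  have d2 := is_derive_compf (is_derive_expR (- C * s)) d1.
  have d3 := is_deriveM d2 (dEE s).
  have d4 := is_deriveZ A (is_derive_id s (1 : R)).
  refine (is_derive_eq (is_deriveB d3 d4) _).
  by rewrite /GRing.scale /= /dpsi; ring.
have cpsi : continuous psi.
  move=> s; apply/differentiable_continuous/derivable1_diffP.
  by have [] := dpsiE s.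
have [c] := @MVT_segment _ psi _ 0 t t0 (fun s _ => dpsiE s) (continuous_subspaceT cpsi).
rewrite in_itv /= => /andP[c0 ct] Epsi.
have dc : dpsi c <= 0.
  rewrite /dpsi subr_le0.
  have e0 := expR_gt0 (- C * c).
  have e1 : expR (- C * c) <= 1 by rewrite expR_le1 mulNr oppr_le0 mulr_ge0.
  have := HE c; rewrite c0 (le_trans ct tT) => /(_ isT) H.
  apply: (@le_trans _ _ (expR (- C * c) * A)).
    by rewrite ler_pM2l // lerBlDr.
  by rewrite ler_piMl.
have : psi t - psi 0 <= 0 by rewrite Epsi subr0 mulr_le0_ge0.
rewrite /psi E0 !mulr0 subr0 subr0 subr_le0 mulNr expRN.
by rewrite ler_pdivrMl ?expR_gt0 // [_ * (A * t)]mulrC.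
Qed.

End Gronwall.

(** * Sums over periodic grids *)

Section Grid.
Context {R : realType}.
Variables (d n : nat).

Definition mesh : R := 2 * pi / n.+1%:R.

(** The base point [x0] is free, so that a grid can start at the point where a function is
    tested. *)
Definition grid (x0 : 'rV[R]_d) (k : {ffun 'I_d -> 'I_n.+1}) : 'rV[R]_d :=
  \row_i (mesh * (k i : nat)%:R) + x0.

Lemma mesh_gt0 : 0 < mesh.
Proof. by rewrite divr_gt0 // twopi_gt0. Qed.

Lemma sum_grid_shift (x0 : 'rV[R]_d) i (f : 'rV[R]_d -> R) : torus_periodic f ->
  \sum_k f (mesh *: basis_vec i + grid x0 k) = \sum_k f (grid x0 k).
Proof.
move=> pf.
pose delta : {ffun 'I_d -> 'I_n.+1} := [ffun j => if j == i then inZp 1 else 0].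
rewrite [RHS](reindex_inj (addIr delta)) /=; apply: eq_bigr => k _.
(* The quotient is 1 exactly when the i-th index wraps around from [n] to 0, and one period has then
   to be removed. *)
pose p : 'rV[int]_d := \row_j (if j == i then - ((k i).+1 %/ n.+1)%:Z else 0).
suff -> : grid x0 (k + delta) = mesh *: basis_vec i + grid x0 k + period p by rewrite pf.
rewrite /grid addrA [RHS]addrAC; congr (_ + x0).
apply/rowP => j; rewrite !mxE !ffunE eqxx /=.
have [->|ji] := eqVneq j i; last by rewrite /= !mulr0 addr0 addn0 modn_small ?add0r.
rewrite mulr1 rmorphN /= mulrN; apply/eqP; rewrite eq_sym subr_eq.
rewrite modnDmr addn1.
have -> : 2 * pi = mesh * n.+1%:R by rewrite divfK // pnatr_eq0.
move: mesh => m; rewrite -pmulrn -mulrA -natrM -mulrDr -natrD addnC mulnC -divn_eq.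
by rewrite -natr1 mulrDr mulr1 addrC.
Qed.

(** The increments of [f] over one mesh cancel in the sum over the grid, and each is [mesh] times
    the derivative at a point within one mesh; [om] bounds the error made in moving that point back
    to the grid. *)
Lemma grid_sum_derive (x0 : 'rV[R]_d) i (f : 'rV[R]_d -> R) om :
  torus_periodic f -> (forall x v, derivable f x v) ->
  (forall x c, `|c| <= mesh ->
     `|'D_(basis_vec i) f x - 'D_(basis_vec i) f (c *: basis_vec i + x)| <= om) ->
  `|\sum_k 'D_(basis_vec i) f (grid x0 k)| <= n.+1%:R ^+ d * om.
Proof.
move=> pf df fom.
have h0 := mesh_gt0.
have MV (k : {ffun 'I_d -> 'I_n.+1}) : exists c : R, `|c| <= mesh /\
    f (mesh *: basis_vec i + grid x0 k) - f (grid x0 k) =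
    mesh * 'D_(basis_vec i) f (c *: basis_vec i + grid x0 k).
  have [c ch E] := @MVT_line R _ f (grid x0 k) (basis_vec i) mesh (fun y => df y _).
  by exists c; rewrite (gtr0_norm h0) in ch.
have /choice[c cP] := MV.
have S0 : \sum_k 'D_(basis_vec i) f (c k *: basis_vec i + grid x0 k) = 0.
  have hn : mesh != 0 by rewrite gt_eqF.
  apply: (mulfI hn); rewrite mulr0 mulr_sumr.
  transitivity (\sum_k (f (mesh *: basis_vec i + grid x0 k) - f (grid x0 k))).
    by apply: eq_bigr => k _; rewrite (cP k).2.
  by rewrite sumrB sum_grid_shift // subrr.
move/(congr1 -%R)/(congr1 (+%R (\sum_k 'D_(basis_vec i) f (grid x0 k)))) : S0.
rewrite oppr0 addr0 => <-; rewrite -sumrB.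
apply: (le_trans (ler_norm_sum _ _ _)).
apply: (@le_trans _ _ (\sum_(k : {ffun 'I_d -> 'I_n.+1}) om)).
  by apply: ler_sum => k _; apply: fom; exact: (cP k).1.
by rewrite sumr_const card_ffun !card_ord -natrX mulr_natl.
Qed.

End Grid.

Section Energy.
Context {R : realType}.
Variable d : nat.

Lemma is_derive_bigsum (V W : normedModType R) I (r : seq I) (f : I -> V -> W) df (x v : V) :
  (forall i, is_derive x v (f i) (df i)) ->
  is_derive x v (fun y => \sum_(i <- r) f i y) (\sum_(i <- r) df i).
Proof.
move=> H; elim: r => [|i r IH].
  rewrite big_nil (_ : (fun y => _) = cst 0); first exact: is_derive_cst.
  by apply/funext => y; rewrite big_nil.
rewrite big_cons (_ : (fun y => _) = f i + (fun y => \sum_(i <- r) f i y)).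
  exact: is_deriveD.
by apply/funext => y; rewrite big_cons.
Qed.

(* Grid sums play the role of integrals over the torus: by the mean value theorem, and because
   a grid sum is invariant under the shift by one mesh, the grid sum of a partial derivative is
   o(number of points), which makes the fluxes [Phi] negligible. *)
Lemma grid_energy_le (en : R * 'rV[R]_d -> R) (Phi : 'I_d -> R * 'rV[R]_d -> R) (T C eps : R) :
  smooth en -> (forall i, smooth (Phi i)) ->
  (forall i t, torus_periodic (fun x => Phi i (t, x))) ->
  0 <= T -> 0 <= C -> 0 < eps ->
  (forall x, en (0, x) = 0) ->
  (forall t x, 0 <= t <= T ->
     'D_(1, 0) en (t, x) <= C * en (t, x) - \sum_i 'D_(0, basis_vec i) (Phi i) (t, x)) ->
  exists2 delta, 0 < delta & forall n (x0 : 'rV[R]_d) t, @mesh R n < delta -> 0 <= t <= T ->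
    \sum_(k : {ffun 'I_d -> 'I_n.+1}) en (t, grid x0 k) <= n.+1%:R ^+ d * eps.
Proof.
move=> sen sPhi pPhi T0 C0 e0 en0 ineq.
pose dPhi i z := 'D_(0, basis_vec i) (Phi i) z.
(* Gronwall's bound is A t exp (C t), where A is the number of grid points times d * om. It must not
   exceed the number of points times [eps] on [0, T], which dictates om = eps / K; the [+ 1] makes
   [K] positive. *)
pose K := d%:R * T * expR (C * T) + 1.
have K0 : 0 < K by rewrite ltr_wpDl // !mulr_ge0 ?ler0n // ltW ?expR_gt0.
pose om := eps / K.
have om0 : 0 < om by rewrite divr_gt0.
have slice i t x v : is_derive x v (fun x => Phi i (t, x)) ('D_(0, v) (Phi i) (t, x)).
  exact: is_derive_affine (affine_slice t) (smooth_derivable (t, x) (0, v) (sPhi i)).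
have unif : forall i, exists delta, 0 < delta /\ forall t x y, `|t| <= T -> `|y| < delta ->
    `|dPhi i (t, x) - dPhi i (t, y + x)| <= om.
  move=> i.
  have cd : continuous (dPhi i) by exact: smooth_continuous (smooth_derive (0, basis_vec i) (sPhi i)).
  have pd t : torus_periodic (fun x => dPhi i (t, x)).
    have E : (fun x => dPhi i (t, x)) = iter_derive [:: basis_vec i] (fun x => Phi i (t, x)).
      by apply/funext => x /=; have [_ ->] := slice i t x (basis_vec i).
    by rewrite E; apply: iter_derive_periodic; exact: pPhi.
  by have [delta d0 H] := slab_unif_continuous T cd pd om0; exists delta.
have /choice[delta deltaP] := unif.
pose dl := \big[Num.min/1]_i (delta i).
have dl0 : 0 < dl.
  by apply: lt_bigmin => // i _; exact: (deltaP i).1.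
have dlle i : dl <= delta i by exact: bigmin_le.
exists dl => // n x0 t meshd tT.
have basis1 i : `|(basis_vec i : 'rV[R]_d)| <= 1.
  rewrite [leLHS]/Num.Def.normr /= mx_normrE; apply: bigmax_le => // -[a b] _ /=.
  by rewrite mxE; case: (_ && _); rewrite ?normr1 ?normr0.
pose E (s : R) := \sum_(k : {ffun 'I_d -> 'I_n.+1}) en (s, grid x0 k).
pose dE (s : R) := \sum_(k : {ffun 'I_d -> 'I_n.+1}) 'D_(1, 0) en (s, grid x0 k).
have dEE (s : R) : is_derive s (1 : R) E (dE s).
  apply: is_derive_bigsum => k.
  exact: is_derive_affine (affine_slice1 (grid x0 k)) (smooth_derivable (s, grid x0 k) (1, 0) sen).
have E0 : E 0 = 0 by rewrite /E big1.
pose A := n.+1%:R ^+ d * (d%:R * om).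
have A0 : 0 <= A by rewrite /A mulr_ge0 ?exprn_ge0 ?ler0n // mulr_ge0 ?ler0n // ltW.
have HE (s : R) : 0 <= s <= T -> dE s <= A + C * E s.
  move=> sT.
  have sT' : `|s| <= T by case/andP: sT => s0 ?; rewrite ger0_norm.
  apply: (@le_trans _ _ (\sum_(k : {ffun 'I_d -> 'I_n.+1})
      (C * en (s, grid x0 k) - \sum_i dPhi i (s, grid x0 k)))).
    by apply: ler_sum => k _; exact: ineq.
  rewrite sumrB -mulr_sumr addrC; apply: lerD => //.
  rewrite exchange_big /= -sumrN.
  apply: (@le_trans _ _ (\sum_(i < d) n.+1%:R ^+ d * om)); last first.
    by rewrite sumr_const card_ord /A mulr_natl mulrnAr.
  apply: ler_sum => i _; rewrite (le_trans (ler_norm _)) // normrN.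
  have E1 x : 'D_(basis_vec i) (fun x => Phi i (s, x)) x = dPhi i (s, x).
    by have [_ ->] := slice i s x (basis_vec i).
  have := @grid_sum_derive R d n x0 i (fun x => Phi i (s, x)) om (pPhi i s).
  have -> : \sum_(k : {ffun 'I_d -> 'I_n.+1}) 'D_(basis_vec i) (fun x => Phi i (s, x)) (grid x0 k) =
      \sum_(k : {ffun 'I_d -> 'I_n.+1}) dPhi i (s, grid x0 k).
    by apply: eq_bigr => k _; exact: E1.
  apply; first by move=> x v; have [] := slice i s x v.
  move=> x c cm; rewrite !E1; apply: (deltaP i).2 => //.
  rewrite normrZ; apply: le_lt_trans (lt_le_trans meshd (dlle i)).
  by apply: le_trans cm; rewrite ler_piMr.
have := gronwall A0 C0 dEE E0 HE tT; rewrite -/(E t) => /le_trans; apply.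
have /andP[t0 tT'] := tT.
have -> : A * t * expR (C * t) = n.+1%:R ^+ d * (om * (d%:R * t * expR (C * t))) by rewrite /A; ring.
rewrite ler_wpM2l ?exprn_ge0 //.
apply: (@le_trans _ _ (om * K)); last by rewrite /om divfK // gt_eqF.
rewrite ler_wpM2l ?(ltW om0) // /K ler_wpDr //.
rewrite -!mulrA ler_wpM2l //.
apply: ler_pM => //; rewrite ?expR_ge0 //.
by rewrite ler_expR ler_wpM2l.
Qed.

End Energy.

(** * From small averages to pointwise vanishing *)

Section Vanish.
Context {R : realType}.
Variable d : nat.

Lemma mesh_lt (r : R) : 0 < r -> exists q, forall n, (q <= n)%N -> @mesh R n < r.
Proof.
move=> r0; exists (Num.bound (2 * pi / r)) => n qn.
rewrite /mesh ltr_pdivrMr // [r * _]mulrC -ltr_pdivrMr //.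
have H : 0 <= 2 * pi / r by rewrite divr_ge0 // ltW // twopi_gt0.
apply: (lt_le_trans (archi_boundP H)).
by rewrite ler_nat leqW.
Qed.

Lemma card_ffun_lt n m : (m <= n.+1)%N ->
  #|ffun_on (fun i : 'I_n.+1 => (i < m)%N) : pred {ffun 'I_d -> 'I_n.+1}| = (m ^ d)%N.
Proof.
move=> mn; rewrite card_ffun_on card_ord; congr (_ ^ _)%N.
rewrite -sum1_card (eq_bigl (fun i : 'I_n.+1 => (i < m)%N)) //.
by rewrite (big_ord_narrow mn) sum1_card card_ord.
Qed.

(** Were [en (t, x)] positive, [en] would be at least half of it on a ball, which contains a fixed
    fraction of the points of suitable fine grids based at [x]. This contradicts [grid_energy_le],
    by which the averages are as small as desired. *)
Lemma energy_vanish (en : R * 'rV[R]_d -> R) (Phi : 'I_d -> R * 'rV[R]_d -> R) (T C : R) :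
  smooth en -> (forall i, smooth (Phi i)) ->
  (forall i t, torus_periodic (fun x => Phi i (t, x))) ->
  0 <= T -> 0 <= C -> (forall z, 0 <= en z) ->
  (forall x, en (0, x) = 0) ->
  (forall t x, 0 <= t <= T ->
     'D_(1, 0) en (t, x) <= C * en (t, x) - \sum_i 'D_(0, basis_vec i) (Phi i) (t, x)) ->
  forall t x, 0 <= t <= T -> en (t, x) = 0.
Proof.
move=> sen sPhi pPhi T0 C0 enge0 en0 ineq t x tT.
apply/eqP; rewrite eq_le enge0 andbT leNgt; apply/negP => eta0.
set eta := en (t, x) in eta0.
have cen : {for x, continuous (fun y => en (t, y))}.
  exact: smooth_continuous (smooth_affine (affine_slice t) sen) x.
have eta2 : 0 < eta / 2 by rewrite divr_gt0.
have [r r0 Br] : exists2 r, 0 < r & forall y, `|y| < r -> eta / 2 <= en (t, y + x).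
  have := cen; move/cvgrPdist_lt => /(_ _ eta2)/nbhs_ballP[r /= r0 rx].
  exists r => // y yr.
  have : ball x r (y + x) by rewrite -ball_normE /= opprD addrCA subrr addr0 normrN.
  move/rx; rewrite -/eta => /(le_lt_trans (ler_norm _)) H.
  by rewrite -(lerD2l (- en (t, y + x) + eta / 2)); move: H; rewrite /=; lra.
have [q qP] := mesh_lt r0.
(* The cube of side 2 pi / Q based at [x] lies in the ball of radius [r]. A grid with Q m points per
   direction has m^d points in it, a proportion Q^-d, whence the value of [eps]; eta / 4 leaves a
   strict gap to eta / 2. *)
pose Q := q.+1.
have Qd0 : 0 < Q%:R ^+ d :> R by rewrite exprn_gt0.
pose eps := eta / 4 / Q%:R ^+ d.
have eps0 : 0 < eps by rewrite !divr_gt0.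
have [delta delta0 small] := grid_energy_le sen sPhi pPhi T0 C0 eps0 en0 ineq.
have [q' q'P] := mesh_lt delta0.
pose m := q'.+1.
pose n := (Q * m).-1.
have nE : n.+1 = (Q * m)%N by rewrite prednK // muln_gt0.
have q'n : (q' <= n)%N by rewrite -ltnS nE leq_pmull.
have := small n x t (q'P _ q'n) tT.
apply/negP; rewrite -ltNge.
pose good := ffun_on (fun i : 'I_n.+1 => (i < m)%N) : pred {ffun 'I_d -> 'I_n.+1}.
apply: (@lt_le_trans _ _ (\sum_(k : {ffun 'I_d -> 'I_n.+1} | good k) (eta / 2))).
  rewrite sumr_const card_ffun_lt; last by rewrite nE leq_pmull.
  rewrite nE -[ltRHS]mulr_natl natrX natrM exprMn /eps.
  have -> : Q%:R ^+ d * m%:R ^+ d * (eta / 4 / Q%:R ^+ d) = m%:R ^+ d * (eta / 4).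
    by field; rewrite ?expf_neq0 ?pnatr_eq0.
  rewrite ltr_pM2l ?exprn_gt0 ?ltr0n //; lra.
rewrite [leRHS](bigID good) /= ler_wpDr //; first by apply: sumr_ge0.
apply: ler_sum => k /ffun_onP gk; rewrite /grid; apply: Br.
apply: rV_norm_lt => // i; rewrite mxE ger0_norm; last exact: mulr_ge0 (ltW (mesh_gt0 _)) (ler0n _ _).
apply: lt_trans (qP q (leqnn q)).
have -> : @mesh R q = @mesh R n * m%:R.
  by rewrite /mesh nE natrM invfM mulrA divfK // pnatr_eq0.
by rewrite ltr_pM2l ?mesh_gt0 // ltr_nat; exact: gk.
Qed.

Lemma affine_time_reversal : affine_map (fun z : R * 'rV[R]_d => (- z.1, z.2)) (fun z => (- z.1, z.2)).
Proof.
split.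
  move=> z.
  have H1 : (fun z : R * 'rV[R]_d => - z.1) z' @[z' --> z] --> - z.1 by apply: cvgN; exact: cvg_fst.
  have H2 : (fun z : R * 'rV[R]_d => z.2) z' @[z' --> z] --> z.2 by exact: cvg_snd.
  exact: (cvg_pair H1 H2).
by move=> x v h; apply/pair_equal_spec; split; rewrite //= opprD scalerN.
Qed.

(** Negative times are reached by changing t into -t and the fluxes into their opposites, which the
    two-sided hypothesis permits. The constant depends on [T] because the gradient of a solution is
    bounded only on bounded time intervals. *)
Lemma energy_vanish_all_times (en : R * 'rV[R]_d -> R) (Phi : 'I_d -> R * 'rV[R]_d -> R) (C : R -> R) :
  smooth en -> (forall i, smooth (Phi i)) ->
  (forall i t, torus_periodic (fun x => Phi i (t, x))) ->
  (forall T, 0 <= C T) -> (forall z, 0 <= en z) ->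
  (forall x, en (0, x) = 0) ->
  (forall T t x, `|t| <= T ->
     `|'D_(1, 0) en (t, x) + \sum_i 'D_(0, basis_vec i) (Phi i) (t, x)| <= C T * en (t, x)) ->
  forall t x, en (t, x) = 0.
Proof.
move=> sen sPhi pPhi C0 enge0 en0 ineq t x.
have [t0|t0] := leP 0 t.
  apply: (@energy_vanish en Phi t (C t)) => //; last by rewrite t0 lexx.
  move=> s y /andP[s0 st]; rewrite lerBrDr.
  by apply: le_trans (ler_norm _) (ineq t s y _); rewrite ger0_norm.
pose rev z : R * 'rV[R]_d := (- z.1, z.2).
have arev := affine_time_reversal.
have nt0 : 0 <= - t by rewrite oppr_ge0 ltW.
have := @energy_vanish (fun z => en (rev z)) (fun i z => - Phi i (rev z)) (- t) (C (- t)).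
move=> /(_ (smooth_affine arev sen) (fun i => smooth_opp (smooth_affine arev (sPhi i)))).
have pr i s : torus_periodic (fun y => - Phi i (rev (s, y))).
  by move=> y k; rewrite (pPhi i (- s)).
move=> /(_ pr nt0 (C0 _) (fun z => enge0 _)).
have en0' y : en (rev (0, y)) = 0 by rewrite /rev /= oppr0.
move=> /(_ en0').
have dt s y : 'D_(1, 0) (fun z => en (rev z)) (s, y) = - 'D_(1, 0) en (- s, y).
  have H1 : is_derive (- s) (1 : R) (fun r => en (r, y)) ('D_(1, 0) en (- s, y)).
    exact: is_derive_affine (affine_slice1 y) (smooth_derivable (- s, y) (1, 0) sen).
  have H2 : is_derive s (1 : R) (fun r => - r) (-1) by exact: is_deriveNid.
  have [_ H3] := is_derive_compf H1 H2.
  have [_ <-] := is_derive_affine (affine_slice1 y)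
     (smooth_derivable (s, y) (1, 0) (smooth_affine arev sen)).
  by rewrite H3 mulrN1.
have dx i s y : 'D_(0, basis_vec i) (fun z => - Phi i (rev z)) (s, y) =
    - 'D_(0, basis_vec i) (Phi i) (- s, y).
  have dPhi := smooth_derivable (rev (s, y)) (rev (0, basis_vec i)) (sPhi i).
  have [_ H] := is_deriveN (is_derive_affine arev dPhi).
  by rewrite /rev /= oppr0 in H; exact: H.
have ineq' s y : 0 <= s <= - t ->
    'D_(1, 0) (fun z => en (rev z)) (s, y) <= C (- t) * en (rev (s, y)) -
     \sum_i 'D_(0, basis_vec i) (fun z => - Phi i (rev z)) (s, y).
  move=> /andP[s0 st]; rewrite dt lerBrDr (eq_bigr _ (fun i _ => dx i s y)) sumrN -opprD.
  rewrite (le_trans (ler_norm _)) // normrN.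
  by apply: ineq; rewrite normrN ger0_norm.
move=> /(_ ineq' (- t) x); rewrite nt0 lexx => /(_ isT).
by rewrite /rev /= opprK.
Qed.

End Vanish.

(** * Energy identity for the difference of two solutions *)

Section Uniqueness.
Context {R : realType}.
Variable d : nat.

(* [A] and [B] are the velocities of two solutions at one point, [DA i j] is the derivative of
   the j-th component in the direction i, [ta] the time derivative, [pa] the pressure gradient,
   and [q] the difference of the pressures. *)
Lemma energy_balance (A B ta tb pa pb : 'I_d -> R) (DA DB : 'I_d -> 'I_d -> R) (q : R) :
  (forall j, ta j + \sum_i A i * DA i j + pa j = 0) ->
  (forall j, tb j + \sum_i B i * DB i j + pb j = 0) ->
  \sum_i DA i i = 0 -> \sum_i DB i i = 0 ->
  let W i := B i - A i in
  \sum_j 2 * (W j * (tb j - ta j)) +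
  \sum_i (B i * (\sum_j 2 * (W j * (DB i j - DA i j))) + (\sum_j W j * W j) * DB i i +
    2 * (W i * (pb i - pa i) + q * (DB i i - DA i i))) =
  - \sum_j \sum_i 2 * (W i * W j * DA i j).
Proof.
move=> HA HB dA dB W.
have H j : tb j - ta j = - (\sum_i (B i * (DB i j - DA i j) + W i * DA i j)) - (pb j - pa j).
  have -> : \sum_i (B i * (DB i j - DA i j) + W i * DA i j) =
     \sum_i B i * DB i j - \sum_i A i * DA i j.
    by rewrite -sumrB; apply: eq_bigr => i _; rewrite /W; ring.
  move: (HA j) (HB j); set sA := \sum_i _; set sB := \sum_i _; move=> ha hb.
  apply/eqP; rewrite -subr_eq0; apply/eqP.
  transitivity ((tb j + sB + pb j) - (ta j + sA + pa j)); first by ring.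
  by rewrite ha hb subrr.
rewrite big_split /= big_split /= -[X in _ + (_ + X + _)]mulr_sumr dB mulr0 addr0.
rewrite -[X in _ + (_ + X)]mulr_sumr big_split /= -[X in _ + (_ + 2 * (_ + X))]mulr_sumr.
rewrite sumrB dA dB subrr mulr0 addr0.
under eq_bigr do rewrite H.
under [X in _ + (X + _)]eq_bigr do rewrite mulr_sumr.
rewrite [X in _ + (X + _)]exchange_big /= mulr_sumr.
rewrite -!big_split /= -sumrN; apply: eq_bigr => j _.
rewrite mulrBr mulrN big_split /= mulrDr.
have -> : \sum_i B i * (2 * (W j * (DB i j - DA i j))) = 2 * (W j * \sum_i (B i * (DB i j - DA i j))).
  by rewrite !mulr_sumr; apply: eq_bigr => i _; ring.
have -> : \sum_i 2 * (W i * W j * DA i j) = 2 * (W j * \sum_i W i * DA i j).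
  by rewrite !mulr_sumr; apply: eq_bigr => i _; ring.
ring.
Qed.

(** Follows from 2 |W_i W_j| <= W_i^2 + W_j^2. *)
Lemma stretching_le (W : 'I_d -> R) (DA : 'I_d -> 'I_d -> R) (M : R) :
  (forall i j, `|DA i j| <= M) ->
  `|- \sum_j \sum_i 2 * (W i * W j * DA i j)| <= 2 * d%:R * M * \sum_j W j * W j.
Proof.
move=> HM; rewrite normrN; apply: (le_trans (ler_norm_sum _ _ _)).
apply: (@le_trans _ _ (\sum_j \sum_i M * (W i * W i + W j * W j))).
  apply: ler_sum => j _; apply: (le_trans (ler_norm_sum _ _ _)).
  apply: ler_sum => i _; rewrite mulrA normrM [M * _]mulrC.
  apply: ler_pM => //; rewrite ler_norml.
  have H1 := sqr_ge0 (W i + W j); have H2 := sqr_ge0 (W i - W j).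
  by apply/andP; split; nra.
have E : \sum_j \sum_i M * (W i * W i + W j * W j) = 2 * d%:R * M * \sum_j W j * W j.
  under eq_bigr do rewrite -mulr_sumr big_split /= sumr_const card_ord.
  rewrite -mulr_sumr big_split /= sumr_const card_ord sumrMnl -mulr_natl; ring.
by rewrite E.
Qed.

Lemma derive_slice (U W : normedModType R) (f : U * 'rV[R]_d -> W) t x v :
  smooth f -> 'D_v (fun y => f (t, y)) x = 'D_(0, v) f (t, x).
Proof.
by move=> sf; have [_] := is_derive_affine (affine_slice t) (smooth_derivable (t, x) (0, v) sf).
Qed.

Lemma derive_slice_time (W : normedModType R) (f : R * 'rV[R]_d -> W) t x :
  smooth f -> 'D_1 (fun s : R => f (s, x)) t = 'D_(1, 0) f (t, x).
Proof.
by move=> sf; have [_] := is_derive_affine (affine_slice1 x) (smooth_derivable (t, x) (1, 0) sf).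
Qed.

Lemma derive_slice_coord (U : normedModType R) n (f : U * 'rV[R]_d -> 'rV[R]_n) t x v j :
  smooth f -> 'D_v (fun y => f (t, y)) x 0 j = 'D_(0, v) (fun z => f z 0 j) (t, x).
Proof.
move=> sf; rewrite (derive_slice _ _ _ sf).
exact: derive_coord (smooth_derivable (t, x) (0, v) sf).
Qed.

Lemma euler_coord (u : R -> 'rV[R]_d -> 'rV[R]_d) (p : R -> 'rV[R]_d -> R) t x j :
  smooth (fun z : R * 'rV[R]_d => u z.1 z.2) -> smooth (fun z : R * 'rV[R]_d => p z.1 z.2) ->
  'D_1 (fun s => u s x) t + convective (u t) x + gradient (p t) x = 0 ->
  'D_(1, 0) (fun z : R * 'rV[R]_d => u z.1 z.2 0 j) (t, x) +
  \sum_i u t x 0 i * 'D_(0, basis_vec i) (fun z : R * 'rV[R]_d => u z.1 z.2 0 j) (t, x) +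
  'D_(0, basis_vec j) (fun z : R * 'rV[R]_d => p z.1 z.2) (t, x) = 0.
Proof.
move=> su sp /(congr1 (fun M : 'rV[R]_d => M 0 j)).
rewrite !mxE => E; rewrite -[RHS]E; congr (_ + _ + _).
- apply: (etrans (esym (derive_coord j (smooth_derivable (t, x) (1, 0) su)))).
  by rewrite -(derive_slice_time t x su).
- rewrite /convective summxE; apply: eq_bigr => i _; rewrite mxE.
  by rewrite -(derive_slice_coord t x (basis_vec i) j su).
- by rewrite -(derive_slice t x (basis_vec j) sp).
Qed.

Lemma divergence_coord (U : normedModType R) (u : U -> 'rV[R]_d -> 'rV[R]_d) t x :
  smooth (fun z : U * 'rV[R]_d => u z.1 z.2) ->
  divergence (u t) x =
  \sum_i 'D_(0, basis_vec i) (fun z : U * 'rV[R]_d => u z.1 z.2 0 i) (t, x).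
Proof.
by move=> su; apply: eq_bigr => i _; rewrite -(derive_slice_coord t x (basis_vec i) i su).
Qed.

(** The energy is transported by [v], so the remaining term contains the gradient of [u] alone,
    bounded on each [-T, T]. The two pressures are unrelated, but their difference enters only
    through a flux. *)
Lemma euler_unique (u0 : 'rV[R]_d -> 'rV[R]_d) (u v : R -> 'rV[R]_d -> 'rV[R]_d) :
  euler_solution u0 u -> euler_solution u0 v -> v = u.
Proof.
move=> [u00 su cu [p [sp pp eu]]] [v00 sv cv [p' [sp' pp' ev]]].
pose a i (z : R * 'rV[R]_d) := u z.1 z.2 0 i.
pose b i (z : R * 'rV[R]_d) := v z.1 z.2 0 i.
pose P (z : R * 'rV[R]_d) := p z.1 z.2.
pose P' (z : R * 'rV[R]_d) := p' z.1 z.2.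
have sP : smooth P by exact: sp.
have sP' : smooth P' by exact: sp'.
have sa i : smooth (a i) by exact: smooth_coord su.
have sb i : smooth (b i) by exact: smooth_coord sv.
have sub (f g : R * 'rV[R]_d -> R) : smooth f -> smooth g -> smooth (fun z => f z - g z).
  by move=> sf sg; exact: smooth_add sf (smooth_opp sg).
pose w i z := b i z - a i z.
pose q z := P' z - P z.
have sw i : smooth (w i) by exact: sub (sb i) (sa i).
have sq : smooth q by exact: sub sP' sP.
pose en z := \sum_j w j z * w j z.
(* The difference satisfies d_t w + (v . grad) w + (w . grad) u + grad q = 0. Multiplied by 2 w, the
   second and the last terms become the divergence of these fluxes, [v] and [w] being divergence
   free. *)
pose Phi i z := b i z * en z + 2 * (w i z * q z).
have sen : smooth en by apply: smooth_sum => j _; exact: smooth_mul (sw j) (sw j).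
have sPhi i : smooth (Phi i).
  exact: smooth_add (smooth_mul (sb i) sen) (smooth_mul (@smooth_cst R _ R 2) (smooth_mul (sw i) sq)).
have pPhi i t : torus_periodic (fun x => Phi i (t, x)).
  have pu : torus_periodic (u t) by case: (cu t).
  have pv : torus_periodic (v t) by case: (cv t).
  move=> x k; rewrite /Phi /en /w /q /a /b /P /P' /= pu pv pp pp'; congr (_ * _ + _).
have dw j V z : is_derive z V (w j) ('D_V (b j) z - 'D_V (a j) z).
  exact: is_deriveB (derivableP (smooth_derivable z V (sb j))) (derivableP (smooth_derivable z V (sa j))).
have dq V z : is_derive z V q ('D_V P' z - 'D_V P z).
  exact: is_deriveB (derivableP (smooth_derivable z V sP')) (derivableP (smooth_derivable z V sP)).
have den V z : is_derive z V en (\sum_j 2 * (w j z * ('D_V (b j) z - 'D_V (a j) z))).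
  apply: is_derive_bigsum => j.
  refine (is_derive_eq (is_deriveM (dw j V z) (dw j V z)) _).
  by rewrite /GRing.scale /=; ring.
have dPhi i V z : is_derive z V (Phi i)
   (b i z * (\sum_j 2 * (w j z * ('D_V (b j) z - 'D_V (a j) z))) + en z * 'D_V (b i) z +
    2 * (w i z * ('D_V P' z - 'D_V P z) + q z * ('D_V (b i) z - 'D_V (a i) z))).
  have db := derivableP (smooth_derivable z V (sb i)).
  have d1 := is_deriveM db (den V z).
  have d2 := is_deriveZ 2 (is_deriveM (dw i V z) (dq V z)).
  have -> : Phi i = (b i * en) + (2 : R) *: (w i * q) by [].
  exact: (is_derive_eq (is_deriveD d1 d2)).
have bounded T : exists2 M, 0 <= M & forall i j t x, `|t| <= T ->
    `|'D_(0, basis_vec i) (a j) (t, x)| <= M.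
  have H (ij : 'I_d * 'I_d) : exists M, 0 < M /\ forall t x, `|t| <= T ->
      `|'D_(0, basis_vec ij.1) (a ij.2) (t, x)| <= M.
    have c1 : continuous ('D_(0, basis_vec ij.1) (a ij.2)).
      exact: smooth_continuous (smooth_derive _ (sa _)).
    have p1 t : torus_periodic (fun x => 'D_(0, basis_vec ij.1) (a ij.2) (t, x)).
      have E : (fun x => 'D_(0, basis_vec ij.1) (a ij.2) (t, x)) =
               iter_derive [:: basis_vec ij.1] (fun x => a ij.2 (t, x)).
        by apply/funext => x; exact: esym (derive_slice t x _ (sa ij.2)).
      rewrite E; apply: iter_derive_periodic => x k.
      by have [pu _ _] := cu t; rewrite /a /= pu.
    by have [M M0 HM] := slab_bounded T c1 p1; exists M.
  have /choice[M MP] := H.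
  exists (\sum_ij M ij); first by apply: sumr_ge0 => ij _; exact/ltW/(MP ij).1.
  move=> i j t x tT; apply: (le_trans ((MP (i, j)).2 t x tT)).
  rewrite (bigD1 (i, j)) //= lerDl; apply: sumr_ge0 => ij _; exact/ltW/(MP ij).1.
have /choice[M MP] : forall T, exists M, 0 <= M /\ forall i j t x, `|t| <= T ->
    `|'D_(0, basis_vec i) (a j) (t, x)| <= M.
  by move=> T; have [M M0 HM] := bounded T; exists M.
have en_eq0 : forall t x, en (t, x) = 0.
  apply: (@energy_vanish_all_times R d en Phi (fun T => 2 * d%:R * M T)) => //.
  - by move=> T; rewrite !mulr_ge0 // (MP T).1.
  - by move=> z; apply: sumr_ge0 => j _; rewrite -expr2 sqr_ge0.
  - by move=> x; apply: big1 => j _; rewrite /w /a /b /= u00 v00 subrr mulr0.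
  move=> T t x tT.
  have -> : 'D_(1, 0) en (t, x) + \sum_i 'D_(0, basis_vec i) (Phi i) (t, x) =
      - \sum_j \sum_i 2 * (w i (t, x) * w j (t, x) * 'D_(0, basis_vec i) (a j) (t, x)).
    have [_ ->] := den (1, 0) (t, x).
    rewrite (eq_bigr _ (fun i _ => derive_val (is_derive := dPhi i (0, basis_vec i) (t, x)))).
    apply: (energy_balance (A := fun i => a i (t, x)) (B := fun i => b i (t, x))).
    - by move=> j; exact: euler_coord su sp (eu t x).
    - by move=> j; exact: euler_coord sv sp' (ev t x).
    - by have [_ _ /(_ x)] := cu t; rewrite (divergence_coord t x su).
    - by have [_ _ /(_ x)] := cv t; rewrite (divergence_coord t x sv).
  by apply: stretching_le => i j; exact: (MP T).2.
apply/funext => t; apply/funext => x; apply/rowP => i.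
have := en_eq0 t x; rewrite /en => /eqP; rewrite psumr_eq0; last first.
  by move=> j _; rewrite -expr2 sqr_ge0.
move=> /allP /(_ i (mem_index_enum i)) /=; rewrite mulf_eq0 orbb subr_eq0.
by move/eqP.
Qed.

End Uniqueness.

(** * Bump functions on the circle *)

Section OneVariable.
Context {R : realType}.
Implicit Types (f df : R -> R) (x : R).

Lemma is_derive_dir f x (v b : R) : is_derive x (1 : R) f b -> is_derive x v f (v * b).
Proof.
move=> [d1 <-].
have df : differentiable f x by exact: (derivable1_diffP f x).1 d1.
have d2 : derivable f x v by exact: diff_derivable.
split => //; have E (u : R) : 'D_u f x = 'd f x u by exact: deriveE.
rewrite !E.
by rewrite -[in LHS](mulr1 v) -[v * 1]/(v *: 1) linearZ.
Qed.

Lemma Ck_real0 f : (forall x, derivable f x 1) -> Ck 0 f.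
Proof.
move=> df; split; last by []. split=> x.
  exact/differentiable_continuous/(derivable1_diffP f x).1/df.
by move=> v; have [] := is_derive_dir v (derivableP (df x)).
Qed.

Lemma Ck_realS k f df : (forall x, is_derive x (1 : R) f (df x)) -> Ck k df -> Ck k.+1 f.
Proof.
move=> fdf Cdf; split; first by apply: (Ck_base (k := 0) (Ck_real0 _)) => x; have [] := fdf x.
move=> v; rewrite (_ : 'D_v f = fun x => v * df x).
  exact: (@Ck_mul R R k (cst v) df (@Ck_cst R R R k v) Cdf).
by apply/funext => x; have [_ ->] := is_derive_dir v (fdf x).
Qed.

Lemma smooth_sin_cos : smooth (sin : R -> R) /\ smooth (cos : R -> R).
Proof.
suff H k : Ck k (sin : R -> R) /\ Ck k (cos : R -> R).
  by split; apply/smoothP => k; case: (H k).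
elim: k => [|k [IHs IHc]]; first by split; apply: Ck_real0 => x.
split; first by apply: Ck_realS IHc => x.
apply: (Ck_realS (df := fun x => -1 * sin x)); last first.
  exact: (@Ck_mul R R k (cst (-1)) sin (@Ck_cst R R R k (-1)) IHs).
by move=> x; rewrite mulN1r; exact: is_derive_cos.
Qed.

(* x^-n exp (-1/x) on the positive axis: this family is stable under derivation. *)
Definition beta n x : R := if 0 < x then x^-1 ^+ n * expR (- x^-1) else 0.

Lemma beta_gt0 n x : 0 < x -> 0 < beta n x.
Proof. by move=> x0; rewrite /beta x0 mulr_gt0 ?expR_gt0 // exprn_gt0 // invr_gt0. Qed.

Lemma beta_eq0 n x : x <= 0 -> beta n x = 0.
Proof. by rewrite leNgt /beta => /negbTE ->. Qed.

Lemma beta_ge0 n x : 0 <= beta n x.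
Proof. by have [/(beta_eq0 n) ->|/(beta_gt0 n)/ltW] := leP x 0. Qed.

(** From exp y >= y^(n+2) / (n+2)! at y = 1/x. This quadratic bound yields the zero derivative at
    the origin, where the two pieces of [beta] meet. *)
Lemma beta_le_sqr n x : beta n x <= (n.+2)`!%:R * x ^+ 2.
Proof.
have [x0|x0] := leP x 0; first by rewrite beta_eq0 // mulr_ge0 // sqr_ge0.
rewrite /beta x0 expRN.
have y0 : 0 < x^-1 by rewrite invr_gt0.
have := expR_ge1Dxn n.+1 (ltW y0); set F := _%:R => H.
have F0 : 0 < F by rewrite ltr0n fact_gt0.
rewrite ler_pdivrMr ?expR_gt0 //.
apply: (@le_trans _ _ (F * x ^+ 2 * (x^-1 ^+ n.+2 / F))).
  rewrite le_eqVlt; apply/orP; left; apply/eqP.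
  rewrite [x^-1 ^+ n.+2]exprSr [x^-1 ^+ n.+1]exprSr; move: (x^-1 ^+ n) => t.
  by field; rewrite !gt_eqF.
rewrite ler_wpM2l ?mulr_ge0 ?sqr_ge0 ?(ltW F0) ?(ltW x0) //.
by apply: (le_trans _ H); rewrite ler_wpDl.
Qed.

Lemma is_derive_sqr_bound f (K : R) : (forall h, `|f h| <= K * h ^+ 2) -> is_derive (0 : R) (1 : R) f 0.
Proof.
move=> fK.
have f0 : f 0 = 0 by apply/eqP; rewrite -normr_le0; have := fK 0; rewrite expr0n mulr0.
have K0 : 0 <= K by have := fK 1; rewrite expr1n mulr1; exact: le_trans.
have H : (fun h : R => h^-1 *: ((f \o shift 0) (h *: (1 : R)) - f 0)) @ 0^' --> (0 : R).
  have K1 : 0 < K + 1 by rewrite ltr_wpDl.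
  apply/cvgrPdist_lt => e e0; near=> h.
  have h0 : h != 0 by near: h; exact: nbhs_dnbhs_neq.
  rewrite sub0r normrN /= /GRing.scale /= mulr1 addr0 f0 subr0 normrM normfV.
  rewrite ltr_pdivrMl ?normr_gt0 //; apply: (le_lt_trans (fK h)).
  have -> : h ^+ 2 = `|h| * `|h| by rewrite -expr2 real_normK ?num_real.
  rewrite mulrCA ltr_pM2l ?normr_gt0 //.
  apply: (@le_lt_trans _ _ ((K + 1) * `|h|)); first by rewrite ler_wpM2r // lerDl.
  by rewrite mulrC -ltr_pdivlMr //; near: h; apply: dnbhs0_lt; rewrite divr_gt0.
by split; [apply/cvg_ex; exists 0|exact: cvg_lim H].
Unshelve. all: by end_near. Qed.

Lemma is_derive_beta n x : is_derive x (1 : R) (beta n) (beta n.+2 x - n%:R * beta n.+1 x).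
Proof.
have [x0|x0|->] := ltgtP x 0.
- rewrite !beta_eq0 ?(ltW x0) // mulr0 subr0.
  apply: (near_eq_is_derive _ (is_derive_cst (0 : R) x (1 : R))).
  by near=> y; rewrite /cst beta_eq0 // ltW //; near: y; exact: lt_nbhsl.
- have xn : x != 0 by rewrite gt_eqF.
  have d0 : is_derive x (1 : R) (fun y => y^-1) (- x ^- 2).
    have H := derivableP (derivableV xn (@derivable_id R R x 1)).
    by apply: (is_derive_eq H); rewrite deriveV // derive_id /GRing.scale /= mulr1.
  have d1 := is_deriveX n d0.
  have d2 := @is_derive_compf R R expR (fun y => - y^-1) x 1 _ _ (is_derive_expR (- x^-1)) (is_deriveN d0).
  have d3 := is_deriveM d1 d2.
  have E : (\near x, ((fun y => y^-1) ^+ n * (fun y => expR (- y^-1))) x = beta n x).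
    near=> y; rewrite /beta (_ : 0 < y) //; last by near: y; exact: lt_nbhsr.
    by rewrite /GRing.mul /= exprfctE.
  apply: (near_eq_is_derive E); apply: (is_derive_eq d3).
  rewrite /beta x0 /GRing.scale /= exprfctE.
  case: n {d1 d3 E} => [|n] /=; first by rewrite !expr0; field.
  by rewrite !exprS -!natr1; field.
rewrite !beta_eq0 // mulr0 subr0.
apply: (is_derive_sqr_bound (K := (n.+2)`!%:R)) => h.
by rewrite ger0_norm ?beta_ge0 // beta_le_sqr.
Unshelve. all: by end_near. Qed.

Lemma smooth_beta n : smooth (beta n).
Proof.
apply/smoothP => k; elim: k n => [|k IH] n.
  by apply: Ck_real0 => x; have [] := is_derive_beta n x.
apply: Ck_realS (is_derive_beta n) _.
have -> : (fun x => beta n.+2 x - n%:R * beta n.+1 x) = (fun x => beta n.+2 x + (- n%:R) * beta n.+1 x).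
  by apply/funext => x; rewrite mulNr.
exact: (Ck_add (IH _) (@Ck_mul R R k (cst (- n%:R)) _ (@Ck_cst R R R k (- n%:R)) (IH _))).
Qed.

End OneVariable.

(** * A cutoff and a smooth periodic squared distance *)

Section Step.
Context {R : realType}.
Implicit Types (s x y : R).

(** Equal to 1 up to s = 1 and to 0 from s = 4 on. The thresholds are squares because the argument
    is a squared distance: the cutoff takes place between one and two units of length. *)
Definition step s : R := beta 0 (4 - s) / (beta 0 (4 - s) + beta 0 (s - 1)).

Lemma step_den_gt0 s : 0 < beta 0 (4 - s) + beta 0 (s - 1).
Proof.
have [s4|s4] := ltP s 4.
  by rewrite ltr_pwDl ?beta_ge0 // beta_gt0 // subr_gt0.
rewrite ltr_wpDl ?beta_ge0 // beta_gt0 //; lra.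
Qed.

Lemma affine_real (a b : R) : affine_map (fun s => a * s + b) (fun s => a * s).
Proof.
split; last by move=> x v h /=; rewrite mulrDr /GRing.scale /= mulrCA addrA.
move=> s; apply: cvgD; last exact: cvg_cst.
by apply: cvgM; [exact: cvg_cst|exact: cvg_id].
Qed.

Lemma smooth_affine_real (f : R -> R) (a b : R) : smooth f -> smooth (fun s => f (a * s + b)).
Proof. exact: smooth_affine (affine_real a b). Qed.

Lemma smooth_step : smooth step.
Proof.
have s1 : smooth (fun s => beta 0 (4 - s)).
  apply: eq_smooth (smooth_affine_real (-1) 4 (smooth_beta 0)) => s.
  by rewrite mulN1r addrC.
have s2 : smooth (fun s => beta 0 (s - 1)).
  apply: eq_smooth (smooth_affine_real 1 (-1) (smooth_beta 0)) => s.
  by rewrite mul1r.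
apply: smooth_mul s1 (smooth_inv _ (smooth_add s1 s2)) => s.
by rewrite gt_eqF // step_den_gt0.
Qed.

Lemma step1 s : s <= 1 -> step s = 1.
Proof.
move=> s1; rewrite /step (@beta_eq0 _ _ (s - 1)) ?subr_le0 // addr0 divff //.
by rewrite gt_eqF // beta_gt0 // subr_gt0 (le_lt_trans s1) // ltr1n.
Qed.

Lemma step0 s : 4 <= s -> step s = 0.
Proof. by move=> s4; rewrite /step beta_eq0 ?subr_le0 // mul0r. Qed.

Lemma step_ge0 s : 0 <= step s.
Proof. by rewrite divr_ge0 ?beta_ge0 // ltW // step_den_gt0. Qed.

Lemma step_le1 s : step s <= 1.
Proof. by rewrite ler_pdivrMr ?step_den_gt0 // mul1r lerDl beta_ge0. Qed.

(* [sqd] is a smooth 2 pi-periodic substitute for the squared distance to 2 pi Z: it equals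
   that square where it is less than 1/4, and is constant far from the lattice. *)
Definition winding x : int := Num.floor (x / (2 * pi) + 2^-1).
Definition residue x : R := x - 2 * pi * (winding x)%:~R.
Definition sqd_profile s : R := 1 + (s - 1) * step (4 * s).
Definition sqd x : R := sqd_profile (residue x ^+ 2).

Lemma smooth_sqd_profile : smooth sqd_profile.
Proof.
have H1 : smooth (fun s => s - 1) := smooth_add (@smooth_id R R) (@smooth_cst R R R (-1)).
have H2 : smooth (fun s => step (4 * s)).
  by apply: eq_smooth (smooth_affine_real 4 0 smooth_step) => s; rewrite addr0.
exact: smooth_add (@smooth_cst R R R 1) (smooth_mul H1 H2).
Qed.

Lemma smooth_sqr_sub (a : R) : smooth (fun x => (x - a) ^+ 2).
Proof.
have H : smooth (fun x => x - a) := smooth_add (@smooth_id R R) (@smooth_cst R R R (- a)).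
by apply: eq_smooth (smooth_mul H H) => x; rewrite expr2.
Qed.

Lemma sqd_profile_near s : s <= 4^-1 -> sqd_profile s = s.
Proof.
move=> s4; rewrite /sqd_profile step1; last by lra.
by rewrite mulr1 addrC subrK.
Qed.

Lemma sqd_profile_far s : 1 <= s -> sqd_profile s = 1.
Proof. by move=> s1; rewrite /sqd_profile step0 ?mulr0 ?addr0 //; lra. Qed.

(** The value lies between [s] and 1. Hence [sqd] takes values under 1/4 only where it is a true
    square. *)
Lemma sqd_profile_ge s : 4^-1 <= s -> 4^-1 <= sqd_profile s.
Proof.
move=> s4; rewrite /sqd_profile.
have := step_ge0 (4 * s); have := step_le1 (4 * s); move: (step _) => t t1 t0.
have [s1|s1] := leP s 1; nra.
Qed.

Lemma sqd_profile_ge0 s : 0 <= s -> 0 <= sqd_profile s.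
Proof.
move=> s0; have [s4|s4] := leP s 4^-1; first by rewrite sqd_profile_near.
by apply: le_trans (sqd_profile_ge (ltW s4)); rewrite invr_ge0.
Qed.

Lemma residueD x (k : int) : residue (x + 2 * pi * k%:~R) = residue x.
Proof.
have p0 : 2 * pi != 0 :> R by rewrite gt_eqF // twopi_gt0.
have E : (x + 2 * pi * k%:~R) / (2 * pi) + 2^-1 = x / (2 * pi) + 2^-1 + k%:~R.
  by rewrite mulrDl [2 * pi * k%:~R]mulrC mulfK // addrAC.
rewrite /residue /winding E floorDrz ?intr_int // intrD intrKfloor.
by move: (2 * pi) => p; ring.
Qed.

Lemma residue_bounds x : - pi <= residue x < pi.
Proof.
have /andP[l u] := floor_itv (x / (2 * pi) + 2^-1).
rewrite -/(winding x) in l u.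
have p0 := @twopi_gt0 R.
rewrite -lerBlDr ler_pdivlMr // in l.
rewrite intrD -ltrBrDr ltr_pdivrMr // in u.
rewrite /residue; apply/andP; split; move: l u; rewrite !mulrBl mulrDl; lra.
Qed.

Lemma sqdD x (k : int) : sqd (x + 2 * pi * k%:~R) = sqd x.
Proof. by rewrite /sqd residueD. Qed.

Lemma sqd_ge0 x : 0 <= sqd x.
Proof. by rewrite sqd_profile_ge0 // sqr_ge0. Qed.

Lemma winding_def x (k : int) : - pi <= x - 2 * pi * k%:~R < pi -> winding x = k.
Proof.
move=> /andP[l u]; apply/eqP; rewrite floor_eq intrD -ltrBrDr -lerBlDr.
have p0 := @twopi_gt0 R.
rewrite ltr_pdivrMr // ler_pdivlMr // !mulrBl mulrDl.
apply/andP; split; lra.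
Qed.

Lemma winding_near x : - pi < residue x -> \forall y \near x, winding y = winding x.
Proof.
move=> lx; have /andP[_ ux] := residue_bounds x.
pose m := Num.min (residue x + pi) (pi - residue x).
have m0 : 0 < m by rewrite lt_min; apply/andP; split; lra.
apply/nbhs_ballP; exists m => //= y; rewrite -ball_normE /= lt_min !ltr_norml => xy.
by apply: winding_def; move: xy; rewrite /residue; lra.
Qed.

(** The winding number is locally constant except at the odd multiples of pi, around which the
    distance to the lattice is at least 1 and the profile is constant. *)
Lemma smooth_sqd : smooth sqd.
Proof.
apply: smooth_local => x; have /andP[+ ux] := residue_bounds x.
rewrite le_eqVlt => /orP[/eqP rx|lx]; last first.
  exists (fun y => sqd_profile ((y - 2 * pi * (winding x)%:~R) ^+ 2)).
    exact: smooth_comp1 smooth_sqd_profile (smooth_sqr_sub _).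
  by apply: filterS (winding_near lx) => y yx; rewrite /sqd /residue yx.
exists (fun=> 1); first exact: smooth_cst.
have p2 := @pi_ge2 R.
apply/nbhs_ballP; exists 1 => //= y; rewrite -ball_normE /= ltr_norml => /andP[xy1 xy2].
apply: sqd_profile_far.
have [xy|xy] := leP x y.
  have -> : residue y = y - 2 * pi * (winding x)%:~R.
    by rewrite /residue (@winding_def y (winding x)) //; move: rx; rewrite /residue; lra.
  by move: rx; rewrite /residue; move: (winding x)%:~R => k rx; nra.
have -> : residue y = y - 2 * pi * (winding x - 1)%:~R.
  rewrite /residue (@winding_def y (winding x - 1)) //; move: rx; rewrite /residue intrB; lra.
by move: rx; rewrite /residue intrB; move: (winding x)%:~R => k rx; nra.
Qed.

Lemma sqd_near x : sqd x < 4^-1 ->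
  exists k : int, sqd x = (x - 2 * pi * k%:~R) ^+ 2 /\
    \forall y \near x, sqd y = (y - 2 * pi * k%:~R) ^+ 2.
Proof.
move=> sx; exists (winding x).
have rx : residue x ^+ 2 < 4^-1.
  by rewrite ltNge; apply/negP => /sqd_profile_ge; rewrite leNgt sx.
have lx : - pi < residue x by have := @pi_ge2 R; nra.
split; first by rewrite /sqd sqd_profile_near // ltW.
have cs : {for x, continuous (fun y => (y - 2 * pi * (winding x)%:~R) ^+ 2)}.
  exact: (smooth_continuous (smooth_sqr_sub _)).
near=> y.
have yx : winding y = winding x by near: y; exact: winding_near.
rewrite /sqd /residue yx sqd_profile_near // ltW //.
near: y; exact: (cs _ (lt_nbhsl rx)).
Unshelve. all: by end_near. Qed.

Lemma sqd_small x : `|x| <= 2^-1 -> sqd x = x ^+ 2.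
Proof.
move=> x2; have p2 := @pi_ge2 R.
have xx : x ^+ 2 <= 4^-1 by move: x2; rewrite ler_norml => /andP[? ?]; nra.
have wx : winding x = 0 by apply: winding_def; move: x2; rewrite mulr0 subr0 ler_norml; lra.
by rewrite /sqd /residue wx mulr0 subr0 sqd_profile_near.
Qed.

End Step.

Section SqdDerivatives.
Context {R : realType}.
Implicit Types (x : R).

Definition dsqd : R -> R := 'D_1 sqd.
Definition ddsqd : R -> R := 'D_1 dsqd.

Lemma smooth_dsqd : smooth dsqd.
Proof. exact: smooth_derive smooth_sqd. Qed.

Lemma is_derive_sqd x : is_derive x (1 : R) sqd (dsqd x).
Proof. exact: derivableP (smooth_derivable x 1 smooth_sqd). Qed.

Lemma is_derive_dsqd x : is_derive x (1 : R) dsqd (ddsqd x).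
Proof. exact: derivableP (smooth_derivable x 1 smooth_dsqd). Qed.

Lemma is_derive_sqr_sub (a : R) x : is_derive x (1 : R) (fun y => (y - a) ^+ 2) (2 * (x - a)).
Proof.
have d1 : is_derive x (1 : R) (fun y => y - a) 1.
  by apply: (is_derive_eq (is_deriveB (is_derive_id x (1 : R)) (is_derive_cst a x (1 : R)))); rewrite subr0.
by apply: (is_derive_eq (is_deriveX 2 d1)); rewrite /GRing.scale /= mulr1 expr1.
Qed.

Lemma dsqd_near x (k : int) : (\forall y \near x, sqd y = (y - 2 * pi * k%:~R) ^+ 2) ->
  dsqd x = 2 * (x - 2 * pi * k%:~R).
Proof.
move=> E; rewrite /dsqd (near_eq_derive _ E).
by have [_] := is_derive_sqr_sub (2 * pi * k%:~R) x.
Qed.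

Lemma ddsqd_near x : sqd x < 4^-1 -> ddsqd x = 2.
Proof.
move=> /sqd_near[k [_ /near_join E]].
have E' : \near x, dsqd x = 2 * (x - 2 * pi * k%:~R).
  by apply: filterS E => y; exact: dsqd_near.
rewrite /ddsqd (near_eq_derive _ E').
have d1 : is_derive x (1 : R) (fun y => y - 2 * pi * k%:~R) 1.
  have c1 := is_derive_cst (2 * pi * k%:~R) x (1 : R).
  by apply: (is_derive_eq (is_deriveB (is_derive_id x (1 : R)) c1)); rewrite subr0.
have [_ ->] := is_deriveZ 2 d1.
by rewrite /GRing.scale /= mulr1.
Qed.

Lemma dsqd_small x : `|x| < 2^-1 -> dsqd x = 2 * x.
Proof.
move=> x2.
have E : \forall y \near x, sqd y = (y - 2 * pi * (0 : int)%:~R) ^+ 2.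
  apply/nbhs_ballP; exists (2^-1 - `|x|); first by rewrite /= subr_gt0.
  move=> y; rewrite -ball_normE /= => xy; rewrite mulr0 subr0 sqd_small //.
  rewrite -[y](subKr x) (le_trans (ler_normB _ _)) //; lra.
by rewrite (dsqd_near E) mulr0 subr0.
Qed.

Lemma derive_translate (V W : normedModType R) (f : V -> W) (a x v : V) :
  (forall y, f (y + a) = f y) -> 'D_v f (x + a) = 'D_v f x.
Proof.
move=> fa; rewrite /derive; set g1 := fun h => h^-1 *: _; set g2 := fun h => h^-1 *: _.
suff -> : g1 = g2 by [].
by apply/funext => h; rewrite /g1 /g2 /= addrA !fa.
Qed.

Lemma dsqdD x (k : int) : dsqd (x + 2 * pi * k%:~R) = dsqd x.
Proof. by apply: derive_translate => y; exact: sqdD. Qed.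

Lemma cosD2pi_int x (k : int) : cos (x + 2 * pi * k%:~R) = cos x.
Proof.
have H (n : nat) (y : R) : cos (y + 2 * pi * n%:R) = cos y.
  have -> : 2 * pi * n%:R = pi *+ 2 *+ n :> R by rewrite mulr_natr mulr_natl.
  exact: (periodicn (@cosD2pi R) n y).
case: (intP k) => [|n|n]; first by rewrite mulr0 addr0.
  exact: H.
by rewrite rmorphN /= mulrN -[LHS](H n.+1) subrK.
Qed.

End SqdDerivatives.

(** * Vortices carried by a shear flow *)

Section Profile.
Context {R : realType}.
Variable r : R.
Implicit Types s : R.

(* The angular velocity of a vortex as a function of the squared radius, chosen so that
   its square has an elementary primitive, the pressure. *)
Definition spin s : R := 2 * beta 1 (2 * (r - s)).
Definition dspin s : R := - 4 * (beta 3 (2 * (r - s)) - beta 2 (2 * (r - s))).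
(** Normalised to vanish outside the vortex, so that the pressures of several vortices can be
    added. *)
Definition vpressure s : R := - 2 * beta 0 (r - s).

Lemma is_derive_affine_arg (f : R -> R) (f' a b s : R) :
  is_derive (a * s + b) (1 : R) f f' -> is_derive s (1 : R) (fun s => f (a * s + b)) (a * f').
Proof.
move=> df.
have d1 : is_derive s (1 : R) (fun s => a * s + b) a.
  apply: (is_derive_eq (is_deriveD (is_deriveZ a (is_derive_id s (1 : R))) (is_derive_cst b s (1 : R)))).
  by rewrite /GRing.scale /= mulr1 addr0.
have H := @is_derive_compf R R f (fun s => a * s + b) s 1 f' a df d1.
by apply: (is_derive_eq H); rewrite mulrC.
Qed.

Lemma spin_argE s : 2 * (r - s) = - 2 * s + 2 * r. Proof. ring. Qed.

Lemma is_derive_spin s : is_derive s (1 : R) spin (dspin s).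
Proof.
have := is_deriveZ 2 (is_derive_affine_arg (is_derive_beta 1 (- 2 * s + 2 * r))).
rewrite (_ : 2 \*: _ = spin); last by apply/funext => t; rewrite /spin spin_argE.
by move/is_derive_eq; apply; rewrite /dspin spin_argE /GRing.scale /=; ring.
Qed.

(** This derivative in the squared radius is what balances the centrifugal force. The factor 2 in
    the argument of [spin] makes its square equal to beta 2 (r - s), and [beta 2] is the derivative
    of [beta 0]. *)
Lemma is_derive_vpressure s : is_derive s (1 : R) vpressure (2 * spin s ^+ 2).
Proof.
have := is_deriveZ (- 2) (is_derive_affine_arg (is_derive_beta 0 (-1 * s + r))).
have rE t : r - t = -1 * t + r by ring.
rewrite (_ : - 2 \*: _ = vpressure); last by apply/funext => t; rewrite /vpressure rE.
move/is_derive_eq; apply; rewrite /spin -rE /GRing.scale /= /beta.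
rewrite mul0r subr0 pmulr_rgt0 //; case: ifP => rs; last by rewrite !(mulr0, expr0n).
have rs0 : r - s != 0 by rewrite gt_eqF.
have -> : expR (- (r - s)^-1) = expR (- (2 * (r - s))^-1) ^+ 2.
  by rewrite -expRM_natl; congr expR; field.
by field.
Qed.

Lemma smooth_spin : smooth spin.
Proof.
apply: (@eq_smooth _ _ _ (fun s => 2 * beta 1 (- 2 * s + 2 * r))); first by move=> s; rewrite /spin spin_argE.
exact: smooth_mul (@smooth_cst R R R 2) (smooth_affine_real (- 2) (2 * r) (smooth_beta 1)).
Qed.

Lemma smooth_vpressure : smooth vpressure.
Proof.
apply: (@eq_smooth _ _ _ (fun s => - 2 * beta 0 (-1 * s + r))).
  by move=> s; rewrite /vpressure mulN1r addrC.
exact: smooth_mul (@smooth_cst R R R (- 2)) (smooth_affine_real (-1) r (smooth_beta 0)).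
Qed.

Lemma spin_eq0 s : r <= s -> spin s = 0.
Proof. by move=> rs; rewrite /spin beta_eq0 ?mulr0 // pmulr_rle0 // subr_le0. Qed.

Lemma dspin_eq0 s : r <= s -> dspin s = 0.
Proof. by move=> rs; rewrite /dspin !beta_eq0 ?subr0 ?mulr0 // pmulr_rle0 // subr_le0. Qed.

Lemma spin_gt0 s : s < r -> 0 < spin s.
Proof. by move=> sr; rewrite /spin mulr_gt0 // beta_gt0 // mulr_gt0 // subr_gt0. Qed.

Lemma spin_ge0 s : 0 <= spin s.
Proof. by rewrite mulr_ge0 // beta_ge0. Qed.

(** In terms of y = 2 (r - s) the profile is 2 y^-1 exp (- y^-1), which increases up to y = 1 only,
    whence r <= 1/2. With a = 1/y >= 1 and a' = 1/y' > a, one has a exp (a' - a) > a (1 + a' - a) >=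
    a'. *)
Lemma spin_lt s s' : r <= 2^-1 -> 0 <= s -> s < r -> s < s' -> spin s' < spin s.
Proof.
move=> r1 s0 sr ss'.
have [rs'|s'r] := leP r s'; first by rewrite (spin_eq0 rs') spin_gt0.
rewrite /spin ltr_pM2l // /beta !pmulr_rgt0 // !subr_gt0 sr s'r !expr1.
set y := 2 * (r - s); set y' := 2 * (r - s').
have y0 : 0 < y by rewrite mulr_gt0 // subr_gt0.
have y'0 : 0 < y' by rewrite mulr_gt0 // subr_gt0.
have y1 : y <= 1 by rewrite /y; lra.
have yy' : y' < y by rewrite /y /y'; lra.
set a := y^-1; set a' := y'^-1.
have a1 : 1 <= a by rewrite -[1]invr1 lef_pV2 ?posrE.
have aa' : a < a' by rewrite ltf_pV2 ?posrE.
have a0 : 0 < a by rewrite invr_gt0.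
have H : 1 + (a' - a) < expR (a' - a) by apply: expR_gt1Dx; rewrite gt_eqF // subr_gt0.
have -> : expR (- a) = expR (- a') * expR (a' - a) by rewrite -expRD; congr expR; ring.
rewrite mulrCA mulrC ltr_pM2l ?expR_gt0 //.
apply: (@le_lt_trans _ _ (a * (1 + (a' - a)))); last by rewrite ltr_pM2l.
nra.
Qed.

Lemma spin_le s s' : r <= 2^-1 -> 0 <= s -> s <= s' -> spin s' <= spin s.
Proof.
move=> r1 s0; rewrite le_eqVlt => /orP[/eqP -> //|ss'].
have [rs|sr] := leP r s; last exact/ltW/spin_lt.
by rewrite spin_eq0 ?spin_ge0 // (le_trans rs) // ltW.
Qed.

End Profile.

(** * Position of the strips *)

Section Strips.
Context {R : realType}.
Variable N : nat.

(** Among N + 4 equally spaced positions, those numbered 0 to N are occupied. *)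
Definition nstrips : R := (N + 4)%:R.
Definition strip_center (j : nat) : R := 2 * pi * j%:R / nstrips.
Definition vradius2 : R := (2 * nstrips ^+ 2)^-1.

Lemma nstrips_ge4 : 4 <= nstrips. Proof. by rewrite ler_nat leq_addl. Qed.

Lemma nstrips_gt0 : 0 < nstrips. Proof. by rewrite (lt_le_trans _ nstrips_ge4). Qed.

Lemma vradius2_gt0 : 0 < vradius2.
Proof. by rewrite invr_gt0 mulr_gt0 // exprn_gt0 // nstrips_gt0. Qed.

Lemma vradius2_le : vradius2 <= 2^-1.
Proof.
rewrite lef_pV2 ?posrE ?mulr_gt0 ?exprn_gt0 ?nstrips_gt0 //.
by rewrite ler_pMr // expr_ge1 ?(ltW nstrips_gt0) // (le_trans _ nstrips_ge4) // ler1n.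
Qed.

Lemma strip_nbhd (y : R) (j : nat) : nstrips ^+ 2 * sqd (y - strip_center j) < 4 ->
  exists k : int, `|nstrips * (y - strip_center j - 2 * pi * k%:~R)| < 2.
Proof.
have M4 := nstrips_ge4; have M0 := nstrips_gt0 => H.
have : sqd (y - strip_center j) < 4^-1.
  have M2 : 16 <= nstrips ^+ 2 by rewrite expr2; nra.
  rewrite -(ltr_pM2l (lt_le_trans _ M2)) //; apply: lt_le_trans H _; lra.
move=> /sqd_near[k [E _]]; exists k.
have : (nstrips * (y - strip_center j - 2 * pi * k%:~R)) ^+ 2 < 4 by rewrite exprMn -E.
by move=> H2; rewrite ltr_norml; apply/andP; split; nra.
Qed.

(** After scaling by [nstrips], a point close to two centre lines makes 2 pi times the integer [n]
    smaller than 4 <= 2 pi, so n = 0. Then N + 4 divides i - j, whose absolute value is at most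
    N. *)
Lemma strips_disjoint (y : R) (i j : nat) : (i <= N)%N -> (j <= N)%N ->
  nstrips ^+ 2 * sqd (y - strip_center i) < 4 -> nstrips ^+ 2 * sqd (y - strip_center j) < 4 -> i = j.
Proof.
move=> iN jN /strip_nbhd[k Hk] /strip_nbhd[l Hl].
have p2 := @pi_ge2 R; have M0 := nstrips_gt0.
have cE m : nstrips * strip_center m = 2 * pi * m%:R.
  by rewrite /strip_center mulrC divfK // gt_eqF.
pose n : int := i%:Z - j%:Z + (N + 4)%:Z * (k - l).
have E : nstrips * (y - strip_center j - 2 * pi * l%:~R) - nstrips * (y - strip_center i - 2 * pi * k%:~R) =
   2 * pi * n%:~R.
  have -> : n%:~R = i%:R - j%:R + nstrips * (k%:~R - l%:~R) :> R.
    by rewrite /n intrD intrM !intrB -!pmulrn.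
  rewrite !mulrBr !cE.
  by move: pi nstrips (k%:~R) (l%:~R) (i%:R) (j%:R) => *; ring.
have nlt : `|n%:~R : R| < 1.
  rewrite -(ltr_pM2l (@twopi_gt0 R)) mulr1 -[X in X * _]gtr0_norm ?twopi_gt0 // -normrM -E.
  apply: (le_lt_trans (ler_normB _ _)); lra.
have n0 : n = 0.
  apply/eqP; rewrite -absz_eq0 -leqn0 -ltnS.
  by move: nlt; rewrite -intr_norm ltrz1 -abszE.
move: n0; rewrite /n => n0.
have : (`|i%:Z - j%:Z| < (N + 4)%:Z) by lia.
have -> : i%:Z - j%:Z = (N + 4)%:Z * (l - k) by lia.
rewrite normrM => H.
have : `|l - k| < 1 by nia.
lia.
Qed.

End Strips.

Section Functionals.
Context {R : realType}.

Lemma smooth_affine_map (V W : normedModType R) (L L0 : V -> W) : affine_map L L0 -> smooth L.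
Proof. by move=> aL; exact: smooth_affine aL (@smooth_id R W). Qed.

Lemma is_derive_affine_map (V W : normedModType R) (L L0 : V -> W) (x v : V) :
  affine_map L L0 -> is_derive x v L (L0 v).
Proof.
move=> aL; have := is_derive_affine aL (@derivable_id R W (L x) (L0 v)).
by rewrite derive_id.
Qed.

Lemma derive_invariant (V W : normedModType R) (f : V -> W) (x v : V) :
  (forall h : R, f (h *: v + x) = f x) -> 'D_v f x = 0.
Proof.
move=> H; rewrite -derive_line.
rewrite (_ : (fun s : R => _) = cst (f x)) ?derive_cst //.
by apply/funext => h; rewrite H.
Qed.

Lemma affine_coord (N d : nat) (k : 'I_d) :
  affine_map (fun z : 'rV[R]_N * 'rV[R]_d => z.2 0 k) (fun z => z.2 0 k).
Proof.
split; last by move=> z v h; rewrite !mxE.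
move=> z; apply: (continuous_comp (f := snd) (g := fun M : 'rV[R]_d => M 0 k)); first exact: cvg_snd.
exact: coord_continuous.
Qed.

Lemma affine_coord1 (N d : nat) (k : 'I_N) :
  affine_map (fun z : 'rV[R]_N * 'rV[R]_d => z.1 0 k) (fun z => z.1 0 k).
Proof.
split; last by move=> z v h; rewrite !mxE.
move=> z; apply: (continuous_comp (f := fst) (g := fun M : 'rV[R]_N => M 0 k)); first exact: cvg_fst.
exact: coord_continuous.
Qed.

Lemma affine_map_sub (V : normedModType R) (f f0 g g0 : V -> R) :
  affine_map f f0 -> affine_map g g0 -> affine_map (fun x => f x - g x) (fun x => f0 x - g0 x).
Proof.
move=> [cf af] [cg ag]; split.
  by move=> x; apply: cvgD; [exact: cf|apply: cvgN; exact: cg].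
by move=> x v h; rewrite af ag scalerBr; rewrite opprD addrACA.
Qed.

Lemma affine_map_sub_cst (V : normedModType R) (f f0 : V -> R) (c : R) :
  affine_map f f0 -> affine_map (fun x => f x - c) f0.
Proof.
move=> [cf af]; split; first by move=> x; apply: cvgB; [exact: cf|exact: cvg_cst].
by move=> x v h; rewrite af addrA.
Qed.

End Functionals.

(** * The family of flows and its smoothness *)

Section Flow.
Context {R : realType}.
Variables (N d : nat) (nu : 'rV[R]_N) (i1 i2 : 'I_d).
Context (i12 : i1 != i2).
Local Notation Z := ('rV[R]_N * 'rV[R]_d)%type.
Local Notation M := (@nstrips R N).
Local Notation r2 := (@vradius2 R N).
Implicit Types (z V : Z) (i j : 'I_N).

(* Coordinates of the point relative to the centre of the j-th vortex, whose abscissa is theta_j. *)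
Definition xi j z : R := z.2 0 i1 - z.1 0 j.
(** The index is a natural number so as to include the strip [N], which carries no vortex. *)
Definition eta (j : nat) z : R := z.2 0 i2 - strip_center N j.
Definition phi j z : R := sqd (xi j z) + sqd (eta j z).

(* Equal to nu_j around the j-th strip, so that the vortex sitting there is carried at that speed;
   strip number N only serves to break the invariance under the remaining translations. *)
Definition background z : R :=
  \sum_(j < N) nu 0 j * step (M ^+ 2 * sqd (eta j z)) +
  step (M ^+ 2 * sqd (eta N z)) * \sum_(k < d | (k != i1) && (k != i2)) cos (z.2 0 k).

(** Each vortex contributes [spin] at [phi] times the rotated gradient of [phi], which is divergence
    free. *)
Definition vel1 z : R := background z - \sum_(j < N) spin r2 (phi j z) * dsqd (eta j z).
Definition vel2 z : R := \sum_(j < N) spin r2 (phi j z) * dsqd (xi j z).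
Definition pres z : R := \sum_(j < N) vpressure r2 (phi j z).
Definition flow (theta : 'rV[R]_N) (x : 'rV[R]_d) : 'rV[R]_d :=
  vel1 (theta, x) *: basis_vec i1 + vel2 (theta, x) *: basis_vec i2.

Lemma affine_xi j : affine_map (xi j) (fun V => V.2 0 i1 - V.1 0 j).
Proof. exact: affine_map_sub (affine_coord N i1) (affine_coord1 d j). Qed.

Lemma affine_eta (j : nat) : affine_map (eta j) (fun V => V.2 0 i2).
Proof. exact: affine_map_sub_cst (affine_coord N i2). Qed.

Lemma smooth_xi j : smooth (xi j).
Proof. exact: smooth_affine_map (affine_xi j). Qed.

Lemma smooth_eta (j : nat) : smooth (eta j).
Proof. exact: smooth_affine_map (affine_eta j). Qed.

Lemma smooth_phi j : smooth (phi j).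
Proof.
exact: smooth_add (smooth_comp1 smooth_sqd (smooth_xi j)) (smooth_comp1 smooth_sqd (smooth_eta j)).
Qed.

Lemma smooth_spin_phi j : smooth (fun z => spin r2 (phi j z)).
Proof. exact: smooth_comp1 (smooth_spin _) (smooth_phi j). Qed.

Lemma smooth_cutoff (j : nat) : smooth (fun z => step (M ^+ 2 * sqd (eta j z))).
Proof.
apply: (smooth_comp1 smooth_step).
exact: smooth_mul (@smooth_cst R Z R (M ^+ 2)) (smooth_comp1 smooth_sqd (smooth_eta j)).
Qed.

Lemma smooth_background : smooth background.
Proof.
apply: (@smooth_add R Z R (fun z => \sum_(j < N) nu 0 j * step (M ^+ 2 * sqd (eta j z)))).
  apply: smooth_sum => j _.
  exact: smooth_mul (@smooth_cst R Z R (nu 0 j)) (smooth_cutoff j).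
apply: (smooth_mul (smooth_cutoff N)); apply: smooth_sum => k _.
exact: smooth_comp1 (smooth_sin_cos (R := R)).2 (smooth_affine_map (affine_coord N k)).
Qed.

Lemma smooth_vel1 : smooth vel1.
Proof.
apply: (smooth_add smooth_background (smooth_opp _)); apply: smooth_sum => j _.
exact: smooth_mul (smooth_spin_phi j) (smooth_comp1 smooth_dsqd (smooth_eta j)).
Qed.

Lemma smooth_vel2 : smooth vel2.
Proof.
apply: smooth_sum => j _.
exact: smooth_mul (smooth_spin_phi j) (smooth_comp1 smooth_dsqd (smooth_xi j)).
Qed.

Lemma smooth_pres : smooth pres.
Proof. by apply: smooth_sum => j _; exact: smooth_comp1 (smooth_vpressure _) (smooth_phi j). Qed.

Lemma smooth_flow : smooth (fun z : Z => flow z.1 z.2).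
Proof.
apply: (@eq_smooth _ _ _ (fun z => vel1 z *: basis_vec i1 + vel2 z *: basis_vec i2)); first by case.
exact: smooth_add (smooth_scalel _ smooth_vel1) (smooth_scalel _ smooth_vel2).
Qed.

Lemma sqd_phi_le j z : sqd (eta j z) <= phi j z.
Proof. by rewrite lerDr sqd_ge0. Qed.

(** The distance in x_2 alone already puts the point outside the other vortices, as 4 / M^2 >=
    r2. *)
Lemma phi_far (i : 'I_N) (j : nat) z : (j <= N)%N -> i != j :> nat ->
  M ^+ 2 * sqd (eta j z) < 4 -> r2 <= phi i z /\ 4 <= M ^+ 2 * sqd (eta i z).
Proof.
move=> jN ij Hj; have M0 := nstrips_gt0 (R := R) N.
have Hi : 4 <= M ^+ 2 * sqd (eta i z).
  rewrite leNgt; apply/negP => Hi; move/eqP: ij; apply.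
  exact: (strips_disjoint (ltnW (ltn_ord i)) jN Hi Hj).
split => //; apply: le_trans (sqd_phi_le i z).
rewrite -(ler_pM2l (exprn_gt0 2 M0)); apply: (@le_trans _ _ 4) => //.
rewrite /vradius2 invfM mulrCA divff ?mulr1 ?gt_eqF ?exprn_gt0 //; lra.
Qed.

Lemma background_strip j z : M ^+ 2 * sqd (eta j z) < 1 -> background z = nu 0 j.
Proof.
move=> Hj; have Hj4 : M ^+ 2 * sqd (eta j z) < 4 by apply: lt_trans Hj _; rewrite ltr1n.
rewrite /background (bigD1 j) //= step1 ?(ltW Hj) // mulr1 big1 => [|i ij].
  rewrite step0 ?mul0r ?addr0 // leNgt; apply/negP => HN.
  have := strips_disjoint (ltnW (ltn_ord j)) (leqnn N) Hj4 HN.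
  by have := ltn_ord j => + jN; rewrite jN ltnn.
by rewrite step0 ?mulr0 //; have [] := phi_far (ltnW (ltn_ord j)) ij Hj4.
Qed.

Lemma background_shear z : M ^+ 2 * sqd (eta N z) < 1 ->
  background z = \sum_(k < d | (k != i1) && (k != i2)) cos (z.2 0 k).
Proof.
move=> HN; have HN4 : M ^+ 2 * sqd (eta N z) < 4 by apply: lt_trans HN _; rewrite ltr1n.
rewrite /background [X in _ + X * _]step1 ?(ltW HN) // mul1r big1 ?add0r // => i _.
rewrite step0 ?mulr0 //.
have iN : (i : nat) != N by rewrite neq_ltn ltn_ord.
by have [] := phi_far (leqnn N) iN HN4.
Qed.

Lemma derive_background_strip j z V : M ^+ 2 * sqd (eta j z) < 1 -> 'D_V background z = 0.
Proof.
move=> Hj.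
have cs : continuous (fun z => M ^+ 2 * sqd (eta j z)).
  apply: smooth_continuous.
  exact: smooth_mul (@smooth_cst R Z R (M ^+ 2)) (smooth_comp1 smooth_sqd (smooth_eta j)).
have E : \near z, background z = cst (nu 0 j) z.
  have H : \near z, M ^+ 2 * sqd (eta j z) < 1 := cs z _ (lt_nbhsl Hj).
  by apply: filterS H => z'; exact: background_strip.
by rewrite (near_eq_derive _ E) derive_cst.
Qed.

Lemma eq_background z z' : (forall k, k != i1 -> z.2 0 k = z'.2 0 k) -> background z = background z'.
Proof.
move=> E; have Ee (j : nat) : eta j z = eta j z' by rewrite /eta E // eq_sym.
rewrite /background.
apply: (congr2 (fun a b => a + b)).
  by apply: eq_bigr => j _; rewrite Ee.
apply: (congr2 (fun a b => a * b)); first by rewrite Ee.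
by apply: eq_bigr => k /andP[k1 _]; rewrite E.
Qed.

Lemma derive_background_i1 z (e : 'rV[R]_N) : 'D_(e, basis_vec i1) background z = 0.
Proof.
apply: derive_invariant => h; apply: eq_background => k ki.
by rewrite !mxE (negbTE ki) /= mulr0 add0r.
Qed.

Lemma derive_background_param z (e : 'rV[R]_N) : 'D_(e, 0) background z = 0.
Proof.
by apply: derive_invariant => h; apply: eq_background => k _; rewrite /= scaler0 add0r.
Qed.

Lemma is_derive_background z V : is_derive z V background ('D_V background z).
Proof. exact: derivableP (smooth_derivable z V smooth_background). Qed.

(** * First derivatives of velocity and pressure *)

Definition dphi j z V : R := (V.2 0 i1 - V.1 0 j) * dsqd (xi j z) + V.2 0 i2 * dsqd (eta j z).

Lemma is_derive_xi (f : R -> R) f' j z V : is_derive (xi j z) (1 : R) f f' ->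
  is_derive z V (fun z => f (xi j z)) ((V.2 0 i1 - V.1 0 j) * f').
Proof.
move=> df; apply: (is_derive_eq (is_derive_compf df (is_derive_affine_map z V (affine_xi j)))).
by rewrite mulrC.
Qed.

Lemma is_derive_eta (f : R -> R) f' (j : nat) z V : is_derive (eta j z) (1 : R) f f' ->
  is_derive z V (fun z => f (eta j z)) (V.2 0 i2 * f').
Proof.
move=> df; apply: (is_derive_eq (is_derive_compf df (is_derive_affine_map z V (affine_eta j)))).
by rewrite mulrC.
Qed.

Lemma is_derive_phi j z V : is_derive z V (phi j) (dphi j z V).
Proof.
exact: is_deriveD (is_derive_xi V (is_derive_sqd (xi j z))) (is_derive_eta V (is_derive_sqd (eta j z))).
Qed.

Lemma is_derive_vel1 z V : is_derive z V vel1 ('D_V background z -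
  \sum_(j < N) (spin r2 (phi j z) * (V.2 0 i2 * ddsqd (eta j z)) +
                dsqd (eta j z) * (dspin r2 (phi j z) * dphi j z V))).
Proof.
apply: is_deriveB (is_derive_background z V) _; apply: is_derive_bigsum => j.
exact: is_deriveM (is_derive_compf (is_derive_spin _ _) (is_derive_phi j z V))
  (is_derive_eta V (is_derive_dsqd (eta j z))).
Qed.

Lemma is_derive_vel2 z V : is_derive z V vel2 (
  \sum_(j < N) (spin r2 (phi j z) * ((V.2 0 i1 - V.1 0 j) * ddsqd (xi j z)) +
                dsqd (xi j z) * (dspin r2 (phi j z) * dphi j z V))).
Proof.
apply: is_derive_bigsum => j.
exact: is_deriveM (is_derive_compf (is_derive_spin _ _) (is_derive_phi j z V))
  (is_derive_xi V (is_derive_dsqd (xi j z))).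
Qed.

Lemma is_derive_pres z V : is_derive z V pres (
  \sum_(j < N) 2 * spin r2 (phi j z) ^+ 2 * dphi j z V).
Proof.
apply: is_derive_bigsum => j.
exact: is_derive_compf (is_derive_vpressure _ _) (is_derive_phi j z V).
Qed.

Lemma flow_i1 : (fun z : Z => flow z.1 z.2 0 i1) = vel1.
Proof.
by apply/funext => -[t x]; rewrite !mxE !eqxx (negbTE i12) /= mulr1 mulr0 addr0.
Qed.

Lemma flow_i2 : (fun z : Z => flow z.1 z.2 0 i2) = vel2.
Proof.
by apply/funext => -[t x]; rewrite !mxE !eqxx [i2 == i1]eq_sym (negbTE i12) /= mulr1 mulr0 add0r.
Qed.

Lemma flow_other k : k != i1 -> k != i2 -> (fun z : Z => flow z.1 z.2 0 k) = cst 0.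
Proof.
by move=> k1 k2; apply/funext => -[t x]; rewrite !mxE (negbTE k1) (negbTE k2) !mulr0 addr0.
Qed.

Lemma sum_flow_directions (F : 'I_d -> R) : (forall k, k != i1 -> k != i2 -> F k = 0) ->
  \sum_k F k = F i1 + F i2.
Proof.
move=> F0; rewrite (bigD1 i1) //= (bigD1 i2) /=; last by rewrite eq_sym.
by rewrite big1 ?addr0 // => k /andP[k1 k2]; exact: F0.
Qed.

Lemma dphi_param j z (e : 'rV[R]_N) : dphi j z (e, 0) = - e 0 j * dsqd (xi j z).
Proof. by rewrite /dphi /= !mxE mul0r addr0 sub0r. Qed.

Lemma dphi_i1 j z : dphi j z (0, basis_vec i1) = dsqd (xi j z).
Proof. by rewrite /dphi /= !mxE !eqxx [i2 == i1]eq_sym (negbTE i12) /= mul0r addr0 subr0 mul1r. Qed.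

Lemma dphi_i2 j z : dphi j z (0, basis_vec i2) = dsqd (eta j z).
Proof. by rewrite /dphi /= !mxE !eqxx (negbTE i12) /= subr0 mul0r add0r mul1r. Qed.

(** Common shape of the vortex parts of the velocity and of all the derivatives below: the summands
    vanish with [spin] and [dspin], so such a sum collapses onto the only active vortex. *)
Definition vsum z (f : 'I_N -> R -> R -> R) : R :=
  \sum_(j < N) f j (spin r2 (phi j z)) (dspin r2 (phi j z)).

Lemma vel1E z : vel1 z = background z - vsum z (fun j a _ => a * dsqd (eta j z)).
Proof. by []. Qed.

Lemma vel2E z : vel2 z = vsum z (fun j a _ => a * dsqd (xi j z)).
Proof. by []. Qed.

Lemma derive_vel1_param z (e : 'rV[R]_N) : 'D_(e, 0) vel1 z =
  vsum z (fun j _ b => e 0 j * (dsqd (eta j z) * b * dsqd (xi j z))).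
Proof.
have [_ ->] := is_derive_vel1 z (e, 0).
rewrite derive_background_param sub0r -sumrN; apply: eq_bigr => j _.
rewrite dphi_param /= mxE.
move: (dsqd (eta j z)) (dsqd (xi j z)) (ddsqd (eta j z)) (ddsqd (xi j z)).
by move: (spin r2 (phi j z)) (dspin r2 (phi j z)) => *; ring.
Qed.

Lemma derive_vel1_i1 z : 'D_(0, basis_vec i1) vel1 z =
  - vsum z (fun j _ b => dsqd (eta j z) * b * dsqd (xi j z)).
Proof.
have [_ ->] := is_derive_vel1 z (0, basis_vec i1).
rewrite derive_background_i1 sub0r; congr (- _); apply: eq_bigr => j _.
rewrite dphi_i1 /= !mxE eqxx [i2 == i1]eq_sym (negbTE i12) /=.
move: (dsqd (eta j z)) (dsqd (xi j z)) (ddsqd (eta j z)) (ddsqd (xi j z)).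
by move: (spin r2 (phi j z)) (dspin r2 (phi j z)) => *; ring.
Qed.

Lemma derive_vel1_i2 z : 'D_(0, basis_vec i2) vel1 z = 'D_(0, basis_vec i2) background z -
  vsum z (fun j a b => a * ddsqd (eta j z) + b * dsqd (eta j z) ^+ 2).
Proof.
have [_ ->] := is_derive_vel1 z (0, basis_vec i2).
congr (_ - _); apply: eq_bigr => j _.
rewrite dphi_i2 /= !mxE !eqxx /=.
move: (dsqd (eta j z)) (dsqd (xi j z)) (ddsqd (eta j z)) (ddsqd (xi j z)).
by move: (spin r2 (phi j z)) (dspin r2 (phi j z)) => *; ring.
Qed.

Lemma derive_vel2_param z (e : 'rV[R]_N) : 'D_(e, 0) vel2 z =
  - vsum z (fun j a b => e 0 j * (a * ddsqd (xi j z) + b * dsqd (xi j z) ^+ 2)).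
Proof.
have [_ ->] := is_derive_vel2 z (e, 0).
rewrite -sumrN; apply: eq_bigr => j _.
rewrite dphi_param /= mxE.
move: (dsqd (eta j z)) (dsqd (xi j z)) (ddsqd (eta j z)) (ddsqd (xi j z)).
by move: (spin r2 (phi j z)) (dspin r2 (phi j z)) => *; ring.
Qed.

Lemma derive_vel2_i1 z : 'D_(0, basis_vec i1) vel2 z =
  vsum z (fun j a b => a * ddsqd (xi j z) + b * dsqd (xi j z) ^+ 2).
Proof.
have [_ ->] := is_derive_vel2 z (0, basis_vec i1).
apply: eq_bigr => j _.
rewrite dphi_i1 /= !mxE !eqxx /=.
move: (dsqd (eta j z)) (dsqd (xi j z)) (ddsqd (eta j z)) (ddsqd (xi j z)).
by move: (spin r2 (phi j z)) (dspin r2 (phi j z)) => *; ring.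
Qed.

Lemma derive_vel2_i2 z : 'D_(0, basis_vec i2) vel2 z =
  vsum z (fun j _ b => dsqd (eta j z) * b * dsqd (xi j z)).
Proof.
have [_ ->] := is_derive_vel2 z (0, basis_vec i2).
apply: eq_bigr => j _.
rewrite dphi_i2 /= !mxE !eqxx (negbTE i12) /=.
move: (dsqd (eta j z)) (dsqd (xi j z)) (ddsqd (eta j z)) (ddsqd (xi j z)).
by move: (spin r2 (phi j z)) (dspin r2 (phi j z)) => *; ring.
Qed.

Lemma derive_pres_i1 z : 'D_(0, basis_vec i1) pres z =
  vsum z (fun j a _ => 2 * a ^+ 2 * dsqd (xi j z)).
Proof.
have [_ ->] := is_derive_pres z (0, basis_vec i1).
by apply: eq_bigr => j _; rewrite dphi_i1.
Qed.

Lemma derive_pres_i2 z : 'D_(0, basis_vec i2) pres z =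
  vsum z (fun j a _ => 2 * a ^+ 2 * dsqd (eta j z)).
Proof.
have [_ ->] := is_derive_pres z (0, basis_vec i2).
by apply: eq_bigr => j _; rewrite dphi_i2.
Qed.

Lemma derive_pres_other z k : k != i1 -> k != i2 -> 'D_(0, basis_vec k) pres z = 0.
Proof.
move=> k1 k2; have [_ ->] := is_derive_pres z (0, basis_vec k).
apply: big1 => j _; rewrite /dphi /= !mxE [i1 == k]eq_sym [i2 == k]eq_sym (negbTE k1) (negbTE k2) /=.
rewrite subr0 (mul0r (dsqd (xi j z))) (mul0r (dsqd (eta j z))) addr0; exact: mulr0.
Qed.

(** A vortex lies on the plateau of its strip and where both [sqd] are true squares, so that their
    second derivatives equal 2. *)
Lemma vortex_strip j z : phi j z < r2 ->
  [/\ M ^+ 2 * sqd (eta j z) < 1, sqd (xi j z) < 4^-1 & sqd (eta j z) < 4^-1].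
Proof.
move=> H; have M0 := nstrips_gt0 (R := R) N; have M4 := nstrips_ge4 (R := R) N.
have M2 : 0 < M ^+ 2 by rewrite exprn_gt0.
have r2M : r2 * M ^+ 2 = 2^-1 by rewrite /vradius2 invfM -mulrA mulVf ?mulr1 // gt_eqF.
have r24 : r2 < 4^-1.
  have M16 : 16 <= M ^+ 2 by rewrite expr2; nra.
  by rewrite -(ltr_pM2r M2) r2M; lra.
have s1 := sqd_ge0 (xi j z); have s2 := sqd_ge0 (eta j z); rewrite /phi in H.
split; [|by lra..].
apply: (@lt_trans _ _ (M ^+ 2 * r2)); first by rewrite ltr_pM2l //; lra.
by rewrite mulrC r2M; lra.
Qed.

(* At each point at most one vortex is active, so the Euler equations need only be checked for a
   single radial vortex in a uniform stream. *)
Lemma vortex_dichotomy z :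
  (forall i, r2 <= phi i z) \/ exists j, phi j z < r2 /\ forall i, i != j -> r2 <= phi i z.
Proof.
have [[j Hj]|H] := pselect (exists j, phi j z < r2); last first.
  by left => i; rewrite leNgt; apply/negP => Hi; apply: H; exists i.
right; exists j; split => // i ij.
have [Hs _ _] := vortex_strip Hj.
have Hs4 : M ^+ 2 * sqd (eta j z) < 4 by apply: lt_trans Hs _; rewrite ltr1n.
by have [] := @phi_far i j z (ltnW (ltn_ord j)) ij Hs4.
Qed.

Lemma vsum_vortex j z (f : 'I_N -> R -> R -> R) :
  (forall i, i != j -> r2 <= phi i z) -> (forall i, f i 0 0 = 0) ->
  vsum z f = f j (spin r2 (phi j z)) (dspin r2 (phi j z)).
Proof.
move=> far f0; rewrite /vsum (bigD1 j) //= big1 ?addr0 // => i ij.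
by rewrite (spin_eq0 (far i ij)) (dspin_eq0 (far i ij)).
Qed.

Lemma vsum_no_vortex z (f : 'I_N -> R -> R -> R) :
  (forall i, r2 <= phi i z) -> (forall i, f i 0 0 = 0) -> vsum z f = 0.
Proof.
by move=> far f0; apply: big1 => i _; rewrite (spin_eq0 (far i)) (dspin_eq0 (far i)).
Qed.

(** * The Euler equations *)

Fact vel_term0 (a : R) : 0 * a = 0. Proof. ring. Qed.
Fact shear_term0 (e a b : R) : e * (a * 0 * b) = 0. Proof. ring. Qed.
Fact stretch_term0 (a b : R) : 0 * a + 0 * b = 0. Proof. ring. Qed.
Fact stretch_term0' (e a b : R) : e * (0 * a + 0 * b) = 0. Proof. ring. Qed.
Fact pressure_term0 (a : R) : 2 * 0 ^+ 2 * a = 0. Proof. ring. Qed.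
Fact shear_term0' (a b : R) : a * 0 * b = 0. Proof. ring. Qed.

(** Outside the vortices each term vanishes: [vel2] is zero and the background depends neither on
    x_1 nor on theta. Inside the j-th one, the derivative along nu cancels the transport by the
    stream nu_j, and what remains is the balance between the centrifugal force and the pressure. *)
Lemma euler_i1 z :
  'D_(nu, 0) vel1 z + (vel1 z * 'D_(0, basis_vec i1) vel1 z + vel2 z * 'D_(0, basis_vec i2) vel1 z) +
  'D_(0, basis_vec i1) pres z = 0.
Proof.
have [far|[j [near far]]] := vortex_dichotomy z.
  have E1 : 'D_(nu, 0) vel1 z = 0.
    rewrite derive_vel1_param; apply: (vsum_no_vortex far) => i.
    refine (shear_term0 (nu 0 i) (dsqd (eta i z)) (dsqd (xi i z))).
  have E2 : 'D_(0, basis_vec i1) vel1 z = 0.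
    rewrite derive_vel1_i1; apply/eqP; rewrite oppr_eq0; apply/eqP.
    apply: (vsum_no_vortex far) => i; refine (shear_term0' (dsqd (eta i z)) (dsqd (xi i z))).
  have E3 : 'D_(0, basis_vec i1) pres z = 0.
    rewrite derive_pres_i1; apply: (vsum_no_vortex far) => i.
    refine (pressure_term0 (dsqd (xi i z))).
  have E4 : vel2 z = 0.
    rewrite vel2E; apply: (vsum_no_vortex far) => i.
    refine (vel_term0 (dsqd (xi i z))).
  by rewrite E1 E2 E3 E4 !(mulr0, mul0r, addr0).
have [Hs /ddsqd_near ddx /ddsqd_near ddy] := vortex_strip near.
pose dx := dsqd (xi j z); pose dy := dsqd (eta j z).
pose a := spin r2 (phi j z); pose b := dspin r2 (phi j z).
have E1 : 'D_(nu, 0) vel1 z = nu 0 j * (dy * b * dx).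
  rewrite derive_vel1_param (vsum_vortex far);
    last by move=> i; refine (shear_term0 (nu 0 i) (dsqd (eta i z)) (dsqd (xi i z))).
  reflexivity.
have E2 : 'D_(0, basis_vec i1) vel1 z = - (dy * b * dx).
  rewrite derive_vel1_i1 (vsum_vortex far);
    last by move=> i; refine (shear_term0' (dsqd (eta i z)) (dsqd (xi i z))).
  reflexivity.
have E3 : 'D_(0, basis_vec i2) vel1 z = - (a * 2 + b * dy ^+ 2).
  rewrite derive_vel1_i2 (@derive_background_strip j z _ Hs) sub0r (vsum_vortex far);
    last by move=> i; refine (stretch_term0 (ddsqd (eta i z)) (dsqd (eta i z) ^+ 2)).
  rewrite ddy; reflexivity.
have E4 : 'D_(0, basis_vec i1) pres z = 2 * a ^+ 2 * dx.
  rewrite derive_pres_i1 (vsum_vortex far);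
    last by move=> i; refine (pressure_term0 (dsqd (xi i z))).
  reflexivity.
have E5 : vel1 z = nu 0 j - a * dy.
  rewrite vel1E (@background_strip j z Hs) (vsum_vortex far);
    last by move=> i; refine (vel_term0 (dsqd (eta i z))).
  reflexivity.
have E6 : vel2 z = a * dx.
  rewrite vel2E (vsum_vortex far);
    last by move=> i; refine (vel_term0 (dsqd (xi i z))).
  reflexivity.
rewrite {}E1 {}E2 {}E3 {}E4 {}E5 {}E6.
move: a b dx dy (nu 0 j) => *; ring.
Qed.

Lemma euler_i2 z :
  'D_(nu, 0) vel2 z + (vel1 z * 'D_(0, basis_vec i1) vel2 z + vel2 z * 'D_(0, basis_vec i2) vel2 z) +
  'D_(0, basis_vec i2) pres z = 0.
Proof.
have [far|[j [near far]]] := vortex_dichotomy z.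
  have E1 : 'D_(nu, 0) vel2 z = 0.
    rewrite derive_vel2_param; apply/eqP; rewrite oppr_eq0; apply/eqP.
    apply: (vsum_no_vortex far) => i; refine (stretch_term0' (nu 0 i) (ddsqd (xi i z)) (dsqd (xi i z) ^+ 2)).
  have E2 : 'D_(0, basis_vec i1) vel2 z = 0.
    rewrite derive_vel2_i1; apply: (vsum_no_vortex far) => i.
    refine (stretch_term0 (ddsqd (xi i z)) (dsqd (xi i z) ^+ 2)).
  have E3 : 'D_(0, basis_vec i2) pres z = 0.
    rewrite derive_pres_i2; apply: (vsum_no_vortex far) => i.
    refine (pressure_term0 (dsqd (eta i z))).
  have E4 : vel2 z = 0.
    rewrite vel2E; apply: (vsum_no_vortex far) => i.
    refine (vel_term0 (dsqd (xi i z))).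
  by rewrite E1 E2 E3 E4 !(mulr0, mul0r, addr0).
have [Hs /ddsqd_near ddx /ddsqd_near ddy] := vortex_strip near.
pose dx := dsqd (xi j z); pose dy := dsqd (eta j z).
pose a := spin r2 (phi j z); pose b := dspin r2 (phi j z).
have E1 : 'D_(nu, 0) vel2 z = - (nu 0 j * (a * 2 + b * dx ^+ 2)).
  rewrite derive_vel2_param (vsum_vortex far);
    last by move=> i; refine (stretch_term0' (nu 0 i) (ddsqd (xi i z)) (dsqd (xi i z) ^+ 2)).
  rewrite ddx; reflexivity.
have E2 : 'D_(0, basis_vec i1) vel2 z = a * 2 + b * dx ^+ 2.
  rewrite derive_vel2_i1 (vsum_vortex far);
    last by move=> i; refine (stretch_term0 (ddsqd (xi i z)) (dsqd (xi i z) ^+ 2)).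
  rewrite ddx; reflexivity.
have E3 : 'D_(0, basis_vec i2) vel2 z = dy * b * dx.
  rewrite derive_vel2_i2 (vsum_vortex far);
    last by move=> i; refine (shear_term0' (dsqd (eta i z)) (dsqd (xi i z))).
  reflexivity.
have E4 : 'D_(0, basis_vec i2) pres z = 2 * a ^+ 2 * dy.
  rewrite derive_pres_i2 (vsum_vortex far);
    last by move=> i; refine (pressure_term0 (dsqd (eta i z))).
  reflexivity.
have E5 : vel1 z = nu 0 j - a * dy.
  rewrite vel1E (@background_strip j z Hs) (vsum_vortex far);
    last by move=> i; refine (vel_term0 (dsqd (eta i z))).
  reflexivity.
have E6 : vel2 z = a * dx.
  rewrite vel2E (vsum_vortex far);
    last by move=> i; refine (vel_term0 (dsqd (xi i z))).
  reflexivity.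
rewrite {}E1 {}E2 {}E3 {}E4 {}E5 {}E6.
move: a b dx dy (nu 0 j) => *; ring.
Qed.

(** * Periodicity, divergence and evolution of the flow *)

Lemma xiD j theta x k l :
  xi j (theta + period k, x + period l) = xi j (theta, x) + 2 * pi * (l 0 i1 - k 0 j)%:~R.
Proof. by rewrite /xi /= !mxE intrB; move: (2 * pi : R) => p; ring. Qed.

Lemma etaD (j : nat) theta x k l :
  eta j (theta + period k, x + period l) = eta j (theta, x) + 2 * pi * (l 0 i2)%:~R.
Proof. by rewrite /eta /= !mxE addrAC. Qed.

Lemma phiD j theta x k l : phi j (theta + period k, x + period l) = phi j (theta, x).
Proof. by rewrite /phi xiD etaD !sqdD. Qed.

Lemma backgroundD theta x k l : background (theta + period k, x + period l) = background (theta, x).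
Proof.
rewrite /background; apply: (congr2 (fun a b => a + b)).
  by apply: eq_bigr => j _; rewrite etaD sqdD.
apply: (congr2 (fun a b => a * b)); first by rewrite etaD sqdD.
by apply: eq_bigr => m _; rewrite /= !mxE cosD2pi_int.
Qed.

Lemma flowD theta x k l : flow (theta + period k) (x + period l) = flow theta x.
Proof.
rewrite /flow; apply: (congr2 (fun a b => a *: basis_vec i1 + b *: basis_vec i2)).
  rewrite /vel1 backgroundD; apply: (congr1 (fun b => background (theta, x) - b)).
  by apply: eq_bigr => j _; rewrite phiD etaD dsqdD.
by apply: eq_bigr => j _; rewrite phiD xiD dsqdD.
Qed.

Lemma presD theta x k l : pres (theta + period k, x + period l) = pres (theta, x).
Proof. by apply: eq_bigr => j _; rewrite phiD. Qed.

Lemma period0 n : period (0 : 'rV[int]_n) = 0 :> 'rV[R]_n.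
Proof. by apply/rowP => i; rewrite !mxE mulr0. Qed.

Lemma flow_periodic_param : torus_periodic flow.
Proof.
move=> theta k; apply/funext => x.
by rewrite -[in LHS](addr0 x) -(period0 d) flowD.
Qed.

Lemma flow_periodic theta : torus_periodic (flow theta).
Proof. by move=> x k; rewrite -[in LHS](addr0 theta) -(period0 N) flowD. Qed.

Lemma pres_periodic theta : torus_periodic (fun x => pres (theta, x)).
Proof. by move=> x k; rewrite -[in LHS](addr0 theta) -(period0 N) presD. Qed.

Lemma flow_divergence theta x : divergence (flow theta) x = 0.
Proof.
rewrite (@divergence_coord R d 'rV[R]_N flow theta x smooth_flow).
rewrite sum_flow_directions => [|k k1 k2]; last first.
  by rewrite (flow_other k1 k2) derive_cst.
rewrite flow_i1 flow_i2 derive_vel1_i1 derive_vel2_i2.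
by rewrite addNr.
Qed.

Lemma flow_jointly_smooth : jointly_smooth_solenoidal flow.
Proof.
split; [exact: smooth_flow|exact: flow_periodic|exact: flow_divergence].
Qed.

Lemma flow_Cinf_div theta : Cinf_div (flow theta).
Proof.
split; [exact: flow_periodic|exact: smooth_slice smooth_flow|exact: flow_divergence].
Qed.

Lemma affine_orbit (theta : 'rV[R]_N) :
  @affine_map R (R * 'rV[R]_d)%type Z (fun w => (theta + w.1 *: nu, w.2)) (fun w => (w.1 *: nu, w.2)).
Proof.
split.
  move=> w.
  have H1 : (fun w : R * 'rV[R]_d => theta + w.1 *: nu) w' @[w' --> w] --> theta + w.1 *: nu.
    apply: cvgD; first exact: cvg_cst.
    by apply: cvgZr_tmp; exact: cvg_fst.
  have H2 : (fun w : R * 'rV[R]_d => w.2) w' @[w' --> w] --> w.2 by exact: cvg_snd.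
  exact: (cvg_pair H1 H2).
by move=> x v h; apply/pair_equal_spec; split => //=; rewrite scalerDl scalerA addrCA.
Qed.

Lemma flow_euler_solution theta : euler_solution (flow theta) (fun t => flow (theta + t *: nu)).
Proof.
have aff := affine_orbit theta.
split.
- by rewrite scale0r addr0.
- exact: smooth_affine aff smooth_flow.
- by move=> t; exact: flow_Cinf_div.
exists (fun t x => pres (theta + t *: nu, x)); split.
- exact: smooth_affine aff smooth_pres.
- by move=> t; exact: pres_periodic.
move=> t x; set z : Z := (theta + t *: nu, x).
apply/rowP => k.
have Dt : 'D_1 (fun s : R => flow (theta + s *: nu) x) t 0 k =
    'D_(nu, 0) (fun z : Z => flow z.1 z.2 0 k) z.
  have aff1 : @affine_map R R Z (fun s => (theta + s *: nu, x)) (fun s => (s *: nu, 0)).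
    split; last by move=> s v h; apply/pair_equal_spec; split;
      rewrite /= ?scaler0 ?add0r // scalerDl scalerA addrCA.
    move=> s.
    have H1 : (fun s : R => theta + s *: nu) s' @[s' --> s] --> theta + s *: nu.
      by apply: cvgD; [exact: cvg_cst|exact: scalel_continuous].
    exact: (cvg_pair H1 (cvg_cst x)).
  have [_] := is_derive_affine aff1
    (smooth_derivable (theta + t *: nu, x) (1 *: nu, 0) smooth_flow).
  rewrite scale1r => /(congr1 (fun M : 'rV[R]_d => M 0 k)) E; apply: (etrans E).
  exact: derive_coord (smooth_derivable z (nu, 0) smooth_flow).
have Dx l : 'D_(basis_vec l) (flow (theta + t *: nu)) x 0 k =
    'D_(0, basis_vec l) (fun z : Z => flow z.1 z.2 0 k) z.
  exact: (@derive_slice_coord R d 'rV[R]_N d (fun z : Z => flow z.1 z.2) (theta + t *: nu) x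
    (basis_vec l) k smooth_flow).
have Dp l : 'D_(basis_vec l) (fun x => pres (theta + t *: nu, x)) x = 'D_(0, basis_vec l) pres z.
  exact: (@derive_slice R d 'rV[R]_N R pres (theta + t *: nu) x (basis_vec l) smooth_pres).
have C : convective (flow (theta + t *: nu)) x 0 k =
    vel1 z * 'D_(0, basis_vec i1) (fun z : Z => flow z.1 z.2 0 k) z +
    vel2 z * 'D_(0, basis_vec i2) (fun z : Z => flow z.1 z.2 0 k) z.
  have F1 : flow (theta + t *: nu) x 0 i1 = vel1 z := congr1 (@^~ z) flow_i1.
  have F2 : flow (theta + t *: nu) x 0 i2 = vel2 z := congr1 (@^~ z) flow_i2.
  rewrite /convective summxE sum_flow_directions => [|l l1 l2]; last first.
    have F3 : flow (theta + t *: nu) x 0 l = 0 := congr1 (@^~ z) (flow_other l1 l2).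
    by rewrite mxE F3 mul0r.
  have S (a : R) (v : 'rV[R]_d) : (a *: v) 0 k = a * v 0 k by rewrite mxE.
  apply: (congr2 (fun a b => a + b)).
    refine (etrans (S _ _) _).
    exact: (congr2 (fun a b => a * b) F1 (Dx i1)).
  refine (etrans (S _ _) _).
  exact: (congr2 (fun a b => a * b) F2 (Dx i2)).
have G : gradient (fun x => pres (theta + t *: nu, x)) x 0 k = 'D_(0, basis_vec k) pres z.
  by rewrite mxE Dp.
rewrite [LHS]mxE [X in X + _]mxE Dt C G mxE.
have [->|k1] := eqVneq k i1.
  by rewrite flow_i1; exact: euler_i1.
have [->|k2] := eqVneq k i2.
  by rewrite flow_i2; exact: euler_i2.
rewrite (flow_other k1 k2) !derive_cst (derive_pres_other z k1 k2).
by rewrite !mulr0 !addr0.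
Qed.

Lemma flow_the_euler_solution theta :
  the_euler_solution (flow theta) (fun t => flow (theta + t *: nu)).
Proof.
split; first exact: flow_euler_solution.
by move=> v; apply: euler_unique; exact: flow_euler_solution.
Qed.

(** * Recovering the parameter from the flow *)

Lemma strip_far (j : nat) z : (j <= N)%N -> M ^+ 2 * sqd (eta j z) < 1 ->
  forall i, i != j :> nat -> r2 <= phi i z.
Proof.
move=> jN Hs i ij.
have Hs4 : M ^+ 2 * sqd (eta j z) < 4 by apply: lt_trans Hs _; rewrite ltr1n.
by have [] := @phi_far i j z jN ij Hs4.
Qed.

Lemma vel1_strip j z : M ^+ 2 * sqd (eta j z) < 1 ->
  vel1 z = nu 0 j - spin r2 (phi j z) * dsqd (eta j z).
Proof.
move=> Hs; rewrite vel1E (background_strip Hs); congr (_ - _).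
rewrite (vsum_vortex (strip_far (ltnW (ltn_ord j)) Hs)); first by [].
by move=> i; exact: vel_term0.
Qed.

Lemma vel2_strip j z : M ^+ 2 * sqd (eta j z) < 1 ->
  vel2 z = spin r2 (phi j z) * dsqd (xi j z).
Proof.
move=> Hs; rewrite vel2E.
rewrite (vsum_vortex (strip_far (ltnW (ltn_ord j)) Hs)); first by [].
by move=> i; exact: vel_term0.
Qed.

Lemma vel1_shear z : M ^+ 2 * sqd (eta N z) < 1 ->
  vel1 z = \sum_(k < d | (k != i1) && (k != i2)) cos (z.2 0 k).
Proof.
move=> Hs; rewrite vel1E (background_shear Hs) (vsum_no_vortex (f := fun j a _ => _)) ?subr0 //.
  by move=> i; apply: (strip_far (leqnn N) Hs); rewrite neq_ltn ltn_ord.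
by move=> i; exact: vel_term0.
Qed.

(* At [offset] above the centre line of the strip j, the velocity is strictly monotone in the
   distance to the j-th vortex, hence determines theta_j. *)
Definition probe (a y : R) : 'rV[R]_d := a *: basis_vec i1 + y *: basis_vec i2.

Lemma probe_i1 a y : probe a y 0 i1 = a.
Proof. by rewrite !mxE !eqxx (negbTE i12) /= mulr1 mulr0 addr0. Qed.

Lemma probe_i2 a y : probe a y 0 i2 = y.
Proof. by rewrite !mxE !eqxx [i2 == i1]eq_sym (negbTE i12) /= mulr1 mulr0 add0r. Qed.

(** On the centre line itself the vortex is invisible in the first component. The value keeps every
    point displaced by at most [offset] in each of the two directions inside the vortex. *)
Definition offset : R := (4 * M)^-1.

Lemma offset_gt0 : 0 < offset.
Proof. by rewrite invr_gt0 mulr_gt0 // nstrips_gt0. Qed.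

Lemma offset_M : offset * M = 4^-1.
Proof. by rewrite /offset invfM -mulrA mulVf ?mulr1 // gt_eqF // nstrips_gt0. Qed.

Lemma offset_lt : offset < 2^-1.
Proof.
have M4 := nstrips_ge4 (R := R) N; have M0 := nstrips_gt0 (R := R) N.
rewrite /offset ltf_pV2 ?posrE ?mulr_gt0 //; lra.
Qed.

Lemma offset_radius : 2 * offset ^+ 2 < r2.
Proof.
have M2 : 0 < M ^+ 2 by rewrite exprn_gt0 // nstrips_gt0.
rewrite -(ltr_pM2r M2) /vradius2 invfM -[2^-1 / _ * _]mulrA mulVf ?gt_eqF // mulr1.
have -> : 2 * offset ^+ 2 * M ^+ 2 = 2 * (offset * M) ^+ 2 by rewrite -mulrA -exprMn.
by rewrite offset_M; lra.
Qed.

Lemma offset_strip (s : R) : `|s| <= offset -> M ^+ 2 * sqd s < 1.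
Proof.
move=> so; have s2 : `|s| <= 2^-1 by apply: le_trans so (ltW offset_lt).
rewrite (sqd_small s2); have M0 := nstrips_gt0 (R := R) N.
have : `|s * M| <= 4^-1 by rewrite normrM (gtr0_norm M0) -offset_M ler_wpM2r // ltW.
by rewrite -exprMn mulrC ler_norml => /andP[? ?]; nra.
Qed.

Lemma flow_detect j theta a :
  flow theta (probe a (strip_center N j + offset)) 0 i1 =
  nu 0 j - spin r2 (sqd (a - theta 0 j) + offset ^+ 2) * (2 * offset).
Proof.
have o0 := offset_gt0; have o2 := offset_lt.
set z : Z := (theta, probe a (strip_center N j + offset)).
have Ee : eta j z = offset by rewrite /eta /= probe_i2 addrC addKr.
have Ex : xi j z = a - theta 0 j by rewrite /xi /= probe_i1.
have -> : flow theta (probe a (strip_center N j + offset)) 0 i1 = vel1 z := congr1 (@^~ z) flow_i1.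
have Hs : M ^+ 2 * sqd (eta j z) < 1 by rewrite Ee offset_strip // gtr0_norm.
have oo : `|offset| < 2^-1 by rewrite gtr0_norm.
by rewrite (vel1_strip Hs) /phi Ee Ex (dsqd_small oo) (sqd_small (ltW oo)).
Qed.

Lemma sqd0 : sqd 0 = 0 :> R.
Proof. by rewrite sqd_small ?normr0 // expr0n. Qed.

Lemma flow_detect0 j theta :
  flow theta (probe (theta 0 j) (strip_center N j + offset)) 0 i1 =
  nu 0 j - spin r2 (offset ^+ 2) * (2 * offset).
Proof.
rewrite flow_detect; congr (_ - spin r2 _ * _).
by rewrite [X in sqd X](subrr (theta 0 j)) sqd0 add0r.
Qed.

Lemma offset_sqr_lt : offset ^+ 2 < r2.
Proof. by have := offset_radius; have := sqr_ge0 offset; lra. Qed.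

Lemma flow_injective theta theta' : flow theta = flow theta' -> torus_eq theta theta'.
Proof.
move=> E.
have H j : exists k : int, theta 0 j = theta' 0 j + 2 * pi * k%:~R.
  have := flow_detect j theta (theta 0 j); rewrite E flow_detect subrr sqd0 add0r.
  have o0 : 2 * offset != 0 by apply: lt0r_neq0; exact: mulr_gt0 (ltr0n R 2) offset_gt0.
  move=> /(@addrI _ (nu 0 j)) /oppr_inj /(mulIf o0) Es.
  have s0 : sqd (theta 0 j - theta' 0 j) = 0.
    apply/eqP; rewrite eq_le sqd_ge0 andbT leNgt; apply/negP => s0.
    have := spin_lt (vradius2_le (R := R) N) (sqr_ge0 offset) offset_sqr_lt
      (_ : _ < sqd (theta 0 j - theta' 0 j) + offset ^+ 2).
    by rewrite Es ltxx ltrDr s0 => /(_ isT).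
  have [|k [+ _]] := @sqd_near R (theta 0 j - theta' 0 j); first by rewrite s0 invr_gt0.
  rewrite s0 => /esym/eqP; rewrite sqrf_eq0 subr_eq0 => /eqP Ek; exists k.
  by rewrite -Ek addrC subrK.
have /choice[k kP] := H.
exists (\row_j - k j); apply/rowP => j.
by rewrite mxE periodE mxE kP rmorphN /= mulrN addrK.
Qed.

Lemma flow_homeo (F : set_system 'rV[R]_N) (theta : 'rV[R]_N) : ProperFilter F ->
  Cinf_cvg (flow @ F) (flow theta) -> torus_cvg F theta.
Proof.
move=> PF cF B /nbhs_ballP[r0 /= r0gt rB].
(* The bound 1/2 keeps r^2 within the threshold 1/4 of [sqd_near]. *)
pose r := Num.min r0 2^-1.
have rgt : 0 < r by rewrite /r lt_min r0gt invr_gt0 ltr0n.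
have r2le : r <= 2^-1 by rewrite /r ge_min lexx orbT.
have rr0 : r <= r0 by rewrite /r ge_min lexx.
have o0 : 0 < 2 * offset by rewrite mulr_gt0 // offset_gt0.
(* The gap between the velocities measured straight above a vortex and at horizontal distance [r]
   from there. A flow closer than this to [flow theta] has each of its vortices within [r] of the
   corresponding one, modulo 2 pi. *)
pose kappa := (spin r2 (offset ^+ 2) - spin r2 (r ^+ 2 + offset ^+ 2)) * (2 * offset).
have kgt : 0 < kappa.
  rewrite mulr_gt0 // subr_gt0 spin_lt ?vradius2_le ?sqr_ge0 ?offset_sqr_lt //.
  by rewrite ltrDr exprn_gt0.
have FF : Filter (flow @ F) by apply: fmap_filter; exact: filter_filter.
have Hc : F [set theta' | forall x, `|flow theta x - flow theta' x| < kappa] :=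
  (Cinf_cvgP (FF := FF) _).1 cF [::] kappa kgt.
have Fl : Filter F by exact: filter_filter.
refine (filterS _ Hc) => theta' /= close.
have H j : exists k : int, `|theta 0 j - theta' 0 j - 2 * pi * k%:~R| < r.
  have D (P Q : 'rV[R]_d) : (P - Q) 0 i1 = P 0 i1 - Q 0 i1 by rewrite !mxE.
  have := le_lt_trans (coord_norm_le _ i1) (close (probe (theta 0 j) (strip_center N j + offset))).
  rewrite (etrans (D _ _) (congr2 (fun a b => a - b) (flow_detect0 j theta) (flow_detect j theta' _))).
  set s0 := spin r2 (offset ^+ 2); set s1 := spin r2 (_ + _).
  have -> : nu 0 j - s0 * (2 * offset) - (nu 0 j - s1 * (2 * offset)) = - ((s0 - s1) * (2 * offset)) by ring.
  rewrite normrN => /(le_lt_trans (ler_norm _)); rewrite /kappa ltr_pM2r // -/s0 => s01.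
  have sr : sqd (theta 0 j - theta' 0 j) < r ^+ 2.
    rewrite ltNge; apply/negP => rs.
    have : s1 <= spin r2 (r ^+ 2 + offset ^+ 2).
      by apply: spin_le (vradius2_le (R := R) N) _ _; rewrite ?addr_ge0 ?sqr_ge0 // lerD2r.
    by move: s01; move: (spin r2 (r ^+ 2 + _)) => s2; lra.
  have [|k [Ek _]] := @sqd_near R (theta 0 j - theta' 0 j).
    by apply: lt_le_trans sr _; rewrite expr2; nra.
  exists k; rewrite Ek in sr.
  by rewrite -(ltr_pXn2r (n := 2)) ?nnegrE // ?(ltW rgt) // real_normK ?num_real.
have /choice[k kP] := H.
exists (theta' + period (\row_j k j)); last by exists (\row_j k j).
apply: rB; rewrite -ball_normE /=; apply: lt_le_trans rr0; apply: rV_norm_lt => // j.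
by rewrite !mxE opprD addrA; exact: kP.
Qed.

(** At the centre of the j-th vortex the first derivative of [sqd] is 0 and the second is 2, so the
    second component of the derivative is - 2 e_j spin(0), with spin(0) > 0. *)
Lemma flow_immersion theta e w :
  Cinf_is_derive flow theta e w -> w = (fun=> 0) -> e = 0.
Proof.
move=> dw w0; apply/rowP => j; rewrite mxE.
have dD := @dparam_is_derive R N d flow theta e flow_jointly_smooth.
pose x := probe (theta 0 j) (strip_center N j).
(* Both [w] and [dparam] are limits of the same difference quotients, hence they agree at [x]. *)
have Dx : dparam flow e theta x = 0.
  apply/eqP; rewrite -normr_le0; apply/ler_addgt0Pr => eps e0; rewrite add0r.
  have e2 : 0 < eps / 2 by rewrite divr_gt0.
  have FF := fmap_filter (fun h x => h^-1 *: (flow (theta + h *: e) x - flow theta x)) (dnbhs_filter (0 : R)).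
  have H1 := (Cinf_cvgP (FF := FF) _).1 dw [::] _ e2.
  have H2 := (Cinf_cvgP (FF := FF) _).1 dD [::] _ e2.
  have [h [/= /(_ x) h1 /(_ x) h2]] := filter_ex (filterI H1 H2).
  rewrite w0 sub0r normrN in h1.
  rewrite -[dparam flow e theta x](subrK (h x)).
  by rewrite (splitr eps) (le_trans (ler_normD _ _)) // lerD // ltW.
set z : Z := (theta, x).
have Ee : eta j z = 0 by rewrite /eta /= probe_i2 subrr.
have Ex : xi j z = 0 by rewrite /xi /= probe_i1 subrr.
have Hs : M ^+ 2 * sqd (eta j z) < 1 by rewrite Ee sqd0 mulr0.
have Ep : phi j z = 0 by rewrite /phi Ee Ex sqd0 addr0.
have dd0 : ddsqd 0 = 2 :> R by apply: ddsqd_near; rewrite sqd0 invr_gt0.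
have d0 : dsqd 0 = 0 :> R by rewrite dsqd_small ?normr0 ?mulr0.
have : 'D_(e, 0) vel2 z = 0.
  have := congr1 (fun A : 'rV[R]_d => A 0 i2) Dx; rewrite mxE.
  rewrite /dparam (derive_coord i2 (smooth_derivable (theta, x) (e, 0) smooth_flow)).
  by rewrite flow_i2.
rewrite derive_vel2_param (vsum_vortex (strip_far (ltnW (ltn_ord j)) Hs)); last first.
  by move=> i; refine (stretch_term0' (e 0 i) (ddsqd (xi i z)) (dsqd (xi i z) ^+ 2)).
rewrite Ex Ep dd0 d0 expr0n /= (mulr0 (dspin r2 0)) addr0.
move: (spin r2 0) (lt0r_neq0 (spin_gt0 (vradius2_gt0 (R := R) N))) => a a0 /eqP.
by rewrite oppr_eq0 !mulf_eq0 (negbTE a0) pnatr_eq0 orbF => /eqP.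
Qed.

Lemma flow_smooth_embedding : smooth_embedding flow.
Proof.
split.
- exact: flow_periodic_param.
- by move=> k; apply: jointly_smooth_Cinf_Ck; exact: flow_jointly_smooth.
- exact: flow_injective.
- exact: flow_immersion.
- exact: flow_homeo.
Qed.

(** * Absence of translation symmetries *)

Lemma cos1_lt1 : cos 1 < 1 :> R.
Proof.
have p2 := @pi_ge2 R; rewrite -[ltRHS]cos0 ltr_cos ?ltr01 //; rewrite in_itv /=; lra.
Qed.

(** Inside a vortex the velocity equals that of the uniform stream at the centre only, so an
    invariance direction has no component along [i1] and [i2]. Along the centre line of strip [N],
    the sum of cosines then leaves its maximum strictly as soon as another component is nonzero. *)
Lemma flow_non_symmetric (N_gt0 : (0 < N)%N) : non_symmetric flow.
Proof.
move=> theta [a a0 inv].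
pose j := Ordinal N_gt0.
have o0 := offset_gt0.
have [a1 a2] : a 0 i1 = 0 /\ a 0 i2 = 0.
  pose x := probe (theta 0 j) (strip_center N j).
  (* Small enough for the translated centre to move by at most [offset] in both directions; the
     [1 +] keeps the denominator positive. *)
  pose s := offset / (1 + `|a 0 i1| + `|a 0 i2|).
  have D0 : 0 < 1 + `|a 0 i1| + `|a 0 i2| by rewrite !ltr_pwDl ?addr_ge0.
  have s0 : 0 < s by rewrite divr_gt0.
  have b1 : `|s * a 0 i1| <= offset.
    rewrite normrM (gtr0_norm s0) /s mulrAC ler_pdivrMr // ler_pM2l //.
    by rewrite -addrA addrCA lerDl addr_ge0.
  have b2 : `|s * a 0 i2| <= offset.
    rewrite normrM (gtr0_norm s0) /s mulrAC ler_pdivrMr // ler_pM2l //.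
    by rewrite lerDr addr_ge0.
  move: s s0 b1 b2 => s s0 b1 b2.
  have small (y : R) : `|y| <= offset -> `|y| < 2^-1 by move/le_lt_trans; apply; exact: offset_lt.
  set z0 : Z := (theta, x); set z : Z := (theta, x + s *: a).
  have Ee0 : eta j z0 = 0 by rewrite /eta /= probe_i2 subrr.
  have Ex0 : xi j z0 = 0 by rewrite /xi /= probe_i1 subrr.
  have Ee : eta j z = s * a 0 i2.
    rewrite /eta /=; have -> : (x + s *: a) 0 i2 = x 0 i2 + s * a 0 i2 by rewrite !mxE.
    by rewrite probe_i2 addrC addKr.
  have Ex : xi j z = s * a 0 i1.
    rewrite /xi /=; have -> : (x + s *: a) 0 i1 = x 0 i1 + s * a 0 i1 by rewrite !mxE.
    by rewrite probe_i1 addrC addKr.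
  have d0 : dsqd 0 = 0 :> R by rewrite dsqd_small ?normr0 ?mulr0.
  have Hs0 : M ^+ 2 * sqd (eta j z0) < 1 by rewrite Ee0 sqd0 mulr0.
  have Hs : M ^+ 2 * sqd (eta j z) < 1 by rewrite Ee offset_strip.
  have pz : 0 < spin r2 (phi j z).
    apply: spin_gt0; apply: le_lt_trans offset_radius.
    rewrite /phi Ee Ex !sqd_small ?(ltW (small _ _)) //.
    move: b1 b2; rewrite !ler_norml => /andP[? ?] /andP[? ?]; nra.
  have V1 : vel1 z = vel1 z0.
    have F (y : 'rV[R]_d) : flow theta y 0 i1 = vel1 (theta, y) := congr1 (@^~ (theta, y)) flow_i1.
    have I := congr1 (fun A : 'rV[R]_d => A 0 i1) (inv x s).
    exact: etrans (esym (F (x + s *: a))) (etrans I (F x)).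
  have V2 : vel2 z = vel2 z0.
    have F (y : 'rV[R]_d) : flow theta y 0 i2 = vel2 (theta, y) := congr1 (@^~ (theta, y)) flow_i2.
    have I := congr1 (fun A : 'rV[R]_d => A 0 i2) (inv x s).
    exact: etrans (esym (F (x + s *: a))) (etrans I (F x)).
  have nz (y : R) : spin r2 (phi j z) * (2 * (s * y)) = 0 -> y = 0.
    move: pz; move: (spin r2 _) => b b0 /eqP.
    by rewrite !mulf_eq0 (gt_eqF b0) (gt_eqF s0) pnatr_eq0 /= => /eqP.
  split; apply: nz.
    by rewrite -(dsqd_small (small _ b1)) -Ex -(vel2_strip Hs) V2 (vel2_strip Hs0) Ex0 d0 mulr0.
  rewrite -(dsqd_small (small _ b2)) -Ee; move: V1.
  have V0 : vel1 z0 = nu 0 j by rewrite (vel1_strip Hs0) Ee0 d0 (mulr0 (spin r2 _)) subr0.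
  rewrite V0 (vel1_strip Hs); move: (spin r2 _ * _) => b /eqP.
  by rewrite subr_eq addrC -subr_eq subrr eq_sym => /eqP.
move/eqP: a0; apply; apply/rowP => k; rewrite mxE.
have [->//|k1] := eqVneq k i1; have [->//|k2] := eqVneq k i2.
apply/eqP/negP => /negP ak.
pose x := probe 0 (strip_center N N).
have E0 (s : R) : eta N (theta, x + s *: a) = 0.
  rewrite /eta /=; have -> : (x + s *: a) 0 i2 = x 0 i2 + s * a 0 i2 by rewrite !mxE.
  by rewrite probe_i2 a2 mulr0 addr0 subrr.
have S (s : R) : flow theta (x + s *: a) 0 i1 =
    \sum_(l < d | (l != i1) && (l != i2)) cos (s * a 0 l).
  have -> : flow theta (x + s *: a) 0 i1 = vel1 (theta, x + s *: a) :=
    congr1 (@^~ (theta, x + s *: a)) flow_i1.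
  rewrite vel1_shear; last by rewrite E0 sqd0 mulr0.
  apply: eq_bigr => l /andP[l1 l2]; congr cos.
  by rewrite /= !mxE (negbTE l1) (negbTE l2) !mulr0 !add0r.
(* At s = 0 all the cosines are 1, whereas at the inverse of a_k the k-th one is cos 1 < 1 and the
   others are at most 1. *)
have I := congr1 (fun A : 'rV[R]_d => A 0 i1) (etrans (inv x (a 0 k)^-1) (esym (inv x 0))).
have := etrans (esym (S (a 0 k)^-1)) (etrans I (S 0)).
rewrite (bigD1 k) /=; last by rewrite k1.
rewrite [RHS](bigD1 k) /=; last by rewrite k1.
rewrite (mulVf ak) (mul0r (a 0 k)) cos0 => E.
have : cos 1 + \sum_(i < d | (i != i1) && (i != i2) && (i != k)) cos ((a 0 k)^-1 * a 0 i) <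
  1 + \sum_(i < d | (i != i1) && (i != i2) && (i != k)) cos (0 * a 0 i).
  apply: ltr_leD; first exact: cos1_lt1.
  by apply: ler_sum => l _; rewrite mul0r cos0 cos_le1.
by rewrite E ltxx.
Qed.

End Flow.

Theorem theorem1p1 (R : realType) (d : nat) (d_ge2 : (2 <= d)%N)
    (d_3_or_even : d = 3%N \/ ~~ odd d)
    (N : nat) (N_ge1 : (1 <= N)%N) (nu : 'rV[R]_N) (nu_neq0 : nu != 0) :
  exists U : 'rV[R]_N -> 'rV[R]_d -> 'rV[R]_d,
    [/\ non_symmetric U,
        smooth_embedding U &
        exists u : 'rV[R]_N -> 'rV[R]_d -> 'rV[R]_d,
          [/\ torus_periodic u,
              forall theta, Cinf_div (u theta) &
              forall theta,
                the_euler_solution (u theta) (fun t => U (theta + t *: nu))]].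
Proof.
pose i1 := Ordinal (ltnW d_ge2); pose i2 := Ordinal d_ge2.
have i12 : i1 != i2 by [].
exists (flow nu i1 i2); split.
- exact: flow_non_symmetric.
- exact: flow_smooth_embedding.
(* The orbit passes through [U theta] at time 0, so the initial data are given by [U] itself. *)
exists (flow nu i1 i2); split.
- exact: flow_periodic_param.
- by move=> theta; exact: flow_Cinf_div.
- by move=> theta; exact: flow_the_euler_solution.
Qed.
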